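(* Let $n\ge 2$, let $\Omega\subset\mathbb{R}^n$ be a bounded convex open domain equipped with its Hilbert metric $h$, and let $f,g$ be two asymptotic geodesic lines in $\Omega$ with common boundary point $\xi=f(+\infty)=g(+\infty)\in\partial\Omega$ (with $f$ and $g$ having distinct images). Let $P$ be the affine plane determined by $f$ and $g$. Suppose that either (a) $\Omega$ is the interior of a convex polytope in $\mathbb{R}^n$, or (b) $\Omega$ is a convex domain with $C^2$ boundary and the curvature of $\partial\Omega$ at $\xi$ along $P$ is not zero. Then there exists $T>0$ such that the function $t\mapsto h(f(t),g(t))$ is convex for $t>T$.
   Context: Hilbert metric: for distinct points $p,q\in\Omega$, let $p'$ and $q'$ be the intersection points of the line through $p$ and $q$ with $\partial\Omega$ which are closest to $p$ and to $q$ respectively. Then $$h(p,q)=\log\frac{|p'-q|\cdot|q'-p|}{|p'-p|\cdot|q'-q|},$$ where $|z-w|$ is the Euclidean distance; and $h(p,p)=0$. Geodesic line: a map $f:\mathbb{R}\to\Omega$ parametrized by $h$-arc length, i.e. $h(f(s),f(t))=|s-t|$ for all $s,t\in\mathbb{R}$, whose image is the intersection of $\Omega$ with a Euclidean straight line. It determines two distinct points of $\partial\Omega$, $f(+\infty)=\lim_{t\to+\infty}f(t)$ and $f(-\infty)=\lim_{t\to-\infty}f(t)$ (Euclidean limits). Two geodesic lines $f,g$ are asymptotic if $f(+\infty)=g(+\infty)$. Plane and curvature: $P$ is the 2-dimensional affine plane containing the images of $f$ and $g$. The curvature of $\partial\Omega$ at $\xi$ along $P$ is the curvature at $\xi$ of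 the planar $C^2$ curve $\partial\Omega\cap P$, regarded as a curve in $P$. *)

(* Defs.v *)
(* Points of R^n are row vectors.  The library norm on
   'rV[R]_n is the sup norm, so the Euclidean norm is defined here; the library
   topology and boundedness on 'rV[R]_n are the Euclidean ones. *)
From HB Require Import structures.
From mathcomp Require Import all_boot all_order all_algebra.
From mathcomp Require Import all_classical all_reals all_analysis.

Set Implicit Arguments.
Unset Strict Implicit.
Unset Printing Implicit Defensive.

Import Order.TTheory GRing.Theory Num.Theory.
Import numFieldNormedType.Exports.

Local Open Scope classical_set_scope.
Local Open Scope ring_scope.

Section EuclideanSpace.
Context {R : realType} {n : nat}.
Implicit Types (x y p q : 'rV[R]_n) (S Omega : set 'rV[R]_n).

Definition dotv x y : R := \sum_i x ord0 i * y ord0 i.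

Definition enorm x : R := Num.sqrt (dotv x x).

Definition boundary S : set 'rV[R]_n := closure S `\` interior S.

Definition affine_flat (k : nat) S : Prop :=
  exists (a : 'rV[R]_n) (M : 'M[R]_n),
    \rank M = k /\ S = [set x | (x - a <= M)%MS].

Definition is_line S : Prop := affine_flat 1 S.

Definition is_plane S : Prop := affine_flat 2 S.

Definition halfspace (a : 'rV[R]_n) (b : R) : set 'rV[R]_n :=
  [set x | dotv a x <= b].

Definition convex_polytope S : Prop :=
  bounded_set S /\
  exists (k : nat) (a : 'I_k -> 'rV[R]_n) (b : 'I_k -> R),
    (forall i, a i != 0) /\ S = \bigcap_(i in [set: 'I_k]) halfspace (a i) (b i).

(* The point where the ray from p through q meets the boundary beyond q.  For
   p != q in a bounded convex open Omega there is exactly one such point; the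
   default value q is then never used. *)
Definition exit_point Omega p q : 'rV[R]_n :=
  xget q [set z | boundary Omega z /\
                  exists2 s : R, 1 < s & z = p + s *: (q - p)].

(* The points on the line are in the order p', p, q, q'. *)
Definition hilbert Omega p q : R :=
  if p == q then 0 else
  let p' := exit_point Omega q p in
  let q' := exit_point Omega p q in
  ln ((enorm (p' - q) * enorm (q' - p)) / (enorm (p' - p) * enorm (q' - q))).

Definition geodesic_line Omega (f : R -> 'rV[R]_n) : Prop :=
  [/\ forall t, Omega (f t),
      forall s t, hilbert Omega (f s) (f t) = `|s - t|
    & exists2 L, is_line L & range f = Omega `&` L].

End EuclideanSpace.

Section Regularity.
Context {R : realType}.

Definition C1_on (V W : normedModType R) (U : set V) (F : V -> W) : Prop :=
  (forall x, U x -> differentiable F x) /\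
  (forall v x, U x -> {for x, continuous ('D_v F)}).

Definition C2_on (V W : normedModType R) (U : set V) (F : V -> W) : Prop :=
  C1_on U F /\ forall v, C1_on U ('D_v F).

Definition C2_boundary {n : nat} (Omega : set 'rV[R]_n) : Prop :=
  forall x, boundary Omega x ->
  exists (U : set 'rV[R]_n) (F : 'rV[R]_n -> R^o),
    [/\ open_nbhs x U, C2_on U F, exists v, 'D_v F x != 0
      & Omega `&` U = [set y | F y < 0] `&` U].

Definition local_arclength_param {n : nat} (C : set 'rV[R]_n) (x : 'rV[R]_n)
    (e : R) (gamma : R^o -> 'rV[R]_n) : Prop :=
  [/\ 0 < e /\ gamma 0 = x,
      C2_on `]- e, e[%classic gamma,
      forall s, s \in `]- e, e[ -> enorm ('D_1 gamma s) = 1,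
      {in `]- e, e[ &, injective gamma}
    & exists2 U, open_nbhs x U & C `&` U = gamma @` `]- e, e[%classic].

(* |gamma''(0)| for an arc-length parametrization gamma; the value does not
   depend on gamma when C is an embedded C^2 curve near x, and it is 0 by
   convention if C has no such parametrization near x. *)
Definition curvature {n : nat} (C : set 'rV[R]_n) (x : 'rV[R]_n) : R :=
  xget 0 [set k | exists (e : R) (gamma : R^o -> 'rV[R]_n),
    local_arclength_param C x e gamma /\ k = enorm ('D_1 ('D_1 gamma) 0)].

End Regularity.

(* Main.v *)
Require Import Defs.
From HB Require Import structures.
From mathcomp Require Import all_boot all_order all_algebra.
From mathcomp Require Import all_classical all_reals all_analysis.
From mathcomp Require Import ring lra.

Set Implicit Arguments.
Unset Strict Implicit.
Unset Printing Implicit Defensive.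

Import Order.TTheory GRing.Theory Num.Theory.
Import numFieldNormedType.Exports.

Local Open Scope classical_set_scope.
Local Open Scope ring_scope.

(** The lines f and g run from boundary points a and b to xi, and arc length for
    the Hilbert metric parametrizes them projectively:
      f t = xi + (a - xi) / (1 + lam * exp t),
      g t = xi + (b - xi) / (1 + mu * exp t).
    The Hilbert distance is the sum of two Funk distances, one for each end of
    the chord through f t and g t, and each Funk distance is a supremum:
      funk p q = sup ln (L p / L q)
    over the affine forms L that are positive on Omega, reached at the forms
    that vanish at the exit point of the ray from p through q
    ([funk_ge_support], [funk_eq_support]). On the two geodesics a form L gives
      ln ((c * lam * exp t + al) / (c * mu * exp t + be))
    with c = L xi, al = L a, be = L b, up to the term
    ln ((1 + mu * exp t) / (1 + lam * exp t)), which depends on t only and is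
    opposite for the two ends. Each Funk distance is therefore replaced by
    [relfunk], where that term is absorbed, and it is enough to show that each
    relfunk is convex for large t. Convexity is proved by exhibiting a support
    line at each point of a half-line.

    For a fixed L the logarithm above has a nondecreasing derivative as soon as
    lam * be <= mu * al and al * be <= c^2 * lam * mu * exp (2 t)
    ([log_ratio_support_line]). The first inequality holds for every L that
    vanishes at an exit point, by comparison with a form that vanishes at b
    ([exit_support_order]); so only the second one has to be made uniform in
    the exit point.
    - In a polytope only finitely many L occur; those with c = 0 give constant
      functions, and the second inequality holds for the others from some time
      on.
    - If the boundary is C^2, let (u1, v1) and (u2, v2) be the coordinates of the
      first two derivatives at xi of the boundary curve, in the basis a - xi,
      b - xi, oriented so that u1 < 0 < v1. If lam * u1 + mu * v1 < 0, the exit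
      points stay away from xi, the ratios al / c and be / c remain bounded
      ([far_support_bounds]), and the second inequality holds again.
    - If lam * u1 + mu * v1 >= 0, the exit points tend to xi along the curve
      and no uniform bound holds. But the exit point xi + u(s) (a - xi) +
      v(s) (b - xi) is reached at the time t with
        exp t = (1 - u - v) / (lam * u + mu * v),
      and relfunk has there the value N = ln (v / - u). Convexity of N as a
      function of t means that N'(s) / t'(s) decreases with s, t being decreasing
      in s. With Taylor expansions at s = 0 its derivative has the sign of
      N'' t' - N' t'', equivalent to - n k / s^2, where k > 0 and n > 0 is a
      multiple of the curvature ([arc_log_ratio_support_lines]). *)

(** * Support lines and one-variable calculus *)

Section Calculus.
Context {R : realType}.
Implicit Types (f g df dg : R -> R) (x a b : R).

(** At a convex combination of x and y, average the two inequalities that the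
    support line there gives at x and at y. *)
Lemma support_lines_convex (T : R) (h : R -> R) :
  (forall t0, T < t0 ->
     exists k, forall t, T < t -> h t0 + k * (t - t0) <= h t) ->
  @convex_function R R^o `]T, +oo[ h.
Proof.
move=> hT p x y; rewrite !inE /= !in_itv /= !andbT => Tx Ty.
rewrite /conv /=.
have p0 : 0 <= p%:num by [].
have p1 : p%:num <= 1 by [].
set q := p%:num in p0 p1 *.
have Tz : T < q * x + (1 - q) * y.
  have : 0 <= q * (x - T) by rewrite mulr_ge0// subr_ge0 ltW.
  have : 0 <= (1 - q) * (y - T) by rewrite mulr_ge0 ?subr_ge0 // ltW.
  have [q0|q0] := ltP 0 q; last by nra.
  have : 0 < q * (x - T) by rewrite mulr_gt0// subr_gt0.
  by nra.
have [k hk] := hT _ Tz.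
have := hk _ Tx; have := hk _ Ty; rewrite /=.
change (h (q * x + (1 - q) * y) + k * (y - (q * x + (1 - q) * y)) <= h y ->
 h (q * x + (1 - q) * y) + k * (x - (q * x + (1 - q) * y)) <= h x ->
 h (q * x + (1 - q) * y) <= q * h x + (1 - q) * h y).
set z := q * x + _; move: (h z) (h x) (h y) => hz hx hy Hy Hx.
have q1 : 0 <= 1 - q by lra.
have := ler_wpM2l p0 Hx; have := ler_wpM2l q1 Hy; rewrite /z; nra.
Qed.

(** A form of eventual convexity that passes to envelopes: a support line of
    a minorant of h that meets h at t0 is a support line of h. *)
Definition eventually_support_lines (h : R -> R) :=
  exists2 T : R, 0 < T & forall t0, T < t0 ->
    exists k, forall t, T < t -> h t0 + k * (t - t0) <= h t.

Lemma eventually_support_lines_sum (h1 h2 h : R -> R) :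
  (forall t, h t = h1 t + h2 t) ->
  eventually_support_lines h1 -> eventually_support_lines h2 ->
  exists2 T : R, 0 < T & @convex_function R R^o `]T, +oo[ h.
Proof.
move=> hE [T1 T10 H1] [T2 T20 H2].
exists (Num.max T1 T2); first by rewrite lt_max T10.
apply: support_lines_convex => t0 Tt0.
have lt_max_max t : Num.max T1 T2 < t -> T1 < t /\ T2 < t.
  by rewrite gt_max => /andP[].
have [T1t0 T2t0] := lt_max_max _ Tt0.
have [k1 hk1] := H1 _ T1t0; have [k2 hk2] := H2 _ T2t0.
exists (k1 + k2) => t /lt_max_max[T1t T2t]; rewrite !hE mulrDl addrACA.
exact: lerD (hk1 _ T1t) (hk2 _ T2t).
Qed.

Lemma is_derive_add f g x a b : is_derive x 1 f a -> is_derive x 1 g b ->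
  is_derive x 1 (fun s => f s + g s) (a + b).
Proof. by move=> fa gb; exact: is_deriveD. Qed.

Lemma is_derive_sub f g x a b : is_derive x 1 f a -> is_derive x 1 g b ->
  is_derive x 1 (fun s => f s - g s) (a - b).
Proof. by move=> fa gb; exact: is_deriveB. Qed.

Lemma is_derive_mul f g x a b : is_derive x 1 f a -> is_derive x 1 g b ->
  is_derive x 1 (fun s => f s * g s) (a * g x + f x * b).
Proof.
move=> fa gb; apply: (@is_derive_eq _ _ _ _ _ _ _ _ (is_deriveM fa gb)).
by rewrite /GRing.scale /=; ring.
Qed.

Lemma is_derive_scale f (k : R) x a : is_derive x 1 f a ->
  is_derive x 1 (fun s => k * f s) (k * a).
Proof. by move=> fa; exact: (is_deriveZ k). Qed.

Lemma is_derive_div f g x a b : g x != 0 ->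
  is_derive x 1 f a -> is_derive x 1 g b ->
  is_derive x 1 (fun s => f s / g s) ((a * g x - f x * b) / g x ^+ 2).
Proof.
move=> gx0 fa gb; apply: (@is_derive_eq _ _ _ _ _ _ _ _
  (is_derive_mul fa (is_deriveV gx0 gb))).
rewrite /GRing.scale /=; field; exact: gx0.
Qed.

Lemma is_derive_ln f x a : 0 < f x -> is_derive x 1 f a ->
  is_derive x 1 (fun s => ln (f s)) (a / f x).
Proof.
move=> fx0 fa; apply: (@is_derive_eq _ _ _ _ _ _ _ _
  (is_derive1_comp (is_derive1_ln fx0) fa)).
by rewrite mulrC.
Qed.

Lemma is_derive_cont f x a : is_derive x 1 f a -> {for x, continuous f}.
Proof.
by move=> [fx _]; apply: differentiable_continuous; apply/derivable1_diffP.
Qed.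

Lemma within_cont_derive f df (i : interval R) :
  (forall x, x \in i -> is_derive x 1 f (df x)) ->
  {within [set` i], continuous f}.
Proof.
move=> fdf; apply: derivable_within_continuous => x xi.
by have [] := fdf x xi.
Qed.

(** A function that decreases before x0 and increases after it is minimal at x0;
    applied to h - k * t, this yields the support line of slope k. *)
Lemma ge_of_derive_sign f df (x0 x : R) :
  (forall y, Num.min x0 x <= y <= Num.max x0 x -> is_derive y 1 f (df y)) ->
  (forall y, Num.min x0 x < y < Num.max x0 x -> 0 <= df y * (y - x0)) ->
  f x0 <= f x.
Proof.
move=> fdf dfs; have [xx0|x0x|->//] := ltgtP x x0.
- have m : Num.min x0 x = x by apply/min_idPr/ltW.
  have M : Num.max x0 x = x0 by apply/max_idPl/ltW.
  rewrite m M in fdf dfs.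
  have [||c cx E] := @MVT R f df x x0 xx0.
  + by move=> y; rewrite in_itv /= => /andP[a b]; apply: fdf; rewrite !ltW.
  + by apply: (@within_cont_derive _ df) => y; rewrite in_itv /=; exact: fdf.
  move: cx; rewrite in_itv /= => /[dup] cx /andP[xc cx0].
  have := dfs c cx; rewrite nmulr_lge0 ?subr_lt0// => dfc.
  by rewrite -subr_le0 E mulr_le0_ge0// subr_ge0 ltW.
- have m : Num.min x0 x = x0 by apply/min_idPl/ltW.
  have M : Num.max x0 x = x by apply/max_idPr/ltW.
  rewrite m M in fdf dfs.
  have [||c cx E] := @MVT R f df x0 x x0x.
  + by move=> y; rewrite in_itv /= => /andP[a b]; apply: fdf; rewrite !ltW.
  + by apply: (@within_cont_derive _ df) => y; rewrite in_itv /=; exact: fdf.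
  move: cx; rewrite in_itv /= => /[dup] cx /andP[xc cx0].
  have := dfs c cx; rewrite pmulr_lge0 ?subr_gt0// => dfc.
  by rewrite -subr_ge0 E mulr_ge0// subr_ge0 ltW.
Qed.

(** L'Hopital's rule against powers of s: it turns limits of the derivatives of
    a boundary curve into the Taylor coefficients of the curve. *)
Lemma cvg_div_exp_right f df (e L : R) (k : nat) : 0 < e ->
  (forall s, s \in `]0, e[ -> is_derive s 1 f (df s)) ->
  f s @[s --> 0^'+] --> 0 ->
  df s / s ^+ k @[s --> 0^'+] --> L ->
  f s / s ^+ k.+1 @[s --> 0^'+] --> L / k.+1%:R.
Proof.
move=> e0 fdf f0 dfL.
have gdg (s : R) : is_derive s 1 (fun s : R => s ^+ k.+1) (k.+1%:R * s ^+ k).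
  have -> : (fun s : R => s ^+ k.+1) = (id : R -> R) ^+ k.+1.
    by apply/funext => y; rewrite exprfctE.
  apply: (@is_derive_eq _ _ _ _ _ _ _ _ (is_deriveX k.+1 (is_derive_id _ _))).
  by rewrite /GRing.scale /= mulr1.
apply: (@lhopital_at_right R f df _ (fun s => k.+1%:R * s ^+ k) 0 e) => //.
- apply: cvg_at_right_filter.
  have := is_derive_cont (gdg 0); rewrite /prop_for /continuous_at.
  by rewrite expr0n.
- move=> s; rewrite in_itv /= => /andP[s0 _].
  by rewrite mulf_neq0 ?expf_neq0 ?pnatr_eq0 ?gt_eqF.
- have -> : (fun s => df s / (k.+1%:R * s ^+ k)) =
            (fun s => df s / s ^+ k * k.+1%:R^-1).
    by apply/funext => s; rewrite invfM mulrA mulrAC.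
  by apply: cvgM => //; exact: cvg_cst.
Qed.

End Calculus.

(** * The logarithmic ratio given by one supporting form *)

Section FixedSupport.
Context {R : realType}.
Implicit Types (lam mu c al be t T : R).

(** Both sides are derivatives, at times with exp t = E1 and exp t = E2, of
    ln ((c * lam * exp t + al) / (c * mu * exp t + be)). The slope equals
    - c * (mu * al - lam * be) divided by
    c^2 * lam * mu * E + al * be / E + (a constant), and the last hypothesis says
    that this denominator grows from E1 to E2. *)
Lemma log_ratio_slope_mono lam mu c al be (E1 E2 : R) :
  0 < lam -> 0 < mu -> 0 < c -> 0 <= al -> 0 <= be -> lam * be <= mu * al ->
  0 < E1 -> E1 <= E2 -> al * be <= c ^+ 2 * lam * mu * (E1 * E2) ->
  c * lam * E1 / (c * lam * E1 + al) - c * mu * E1 / (c * mu * E1 + be) <=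
  c * lam * E2 / (c * lam * E2 + al) - c * mu * E2 / (c * mu * E2 + be).
Proof.
move=> l0 m0 c0 a0 b0 lbma E10 E12 ab.
have E20 : 0 < E2 by lra.
have cl : 0 < c * lam by rewrite mulr_gt0.
have cm : 0 < c * mu by rewrite mulr_gt0.
have A1 : 0 < c * lam * E1 + al by rewrite ltr_wpDr // mulr_gt0.
have A2 : 0 < c * lam * E2 + al by rewrite ltr_wpDr // mulr_gt0.
have B1 : 0 < c * mu * E1 + be by rewrite ltr_wpDr // mulr_gt0.
have B2 : 0 < c * mu * E2 + be by rewrite ltr_wpDr // mulr_gt0.
rewrite -subr_ge0.
rewrite [X in 0 <= X](_ : _ = (mu * al - lam * be) * (E2 - E1) * c *
   (c ^+ 2 * lam * mu * (E1 * E2) - al * be) /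
   ((c * lam * E1 + al) * (c * lam * E2 + al) * (c * mu * E1 + be) *
    (c * mu * E2 + be))); last first.
  by field; rewrite !gt_eqF.
rewrite divr_ge0 ?mulr_ge0 ?subr_ge0 // ?ltW //.
Qed.

(** If c = 0 the function is constant, and the bound on al * be would fail: this
    is the case of a form that vanishes at xi. *)
Lemma log_ratio_support_line T lam mu c al be :
  0 < lam -> 0 < mu -> 0 <= c -> 0 <= al -> 0 <= be -> lam * be <= mu * al ->
  c = 0 \/ 0 < c /\ al * be <= c ^+ 2 * lam * mu * expR T ^+ 2 ->
  let psi t := ln ((c * lam * expR t + al) / (c * mu * expR t + be)) in
  forall t0, T < t0 ->
    exists k, forall t, T < t -> psi t0 + k * (t - t0) <= psi t.
Proof.
move=> l0 m0 c0 a0 b0 lbma H psi t0 Tt0.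
case: H => [cE|[{}c0 ab]].
  by exists 0 => t _; rewrite /psi cE !(mul0r, add0r) addr0.
pose d t := c * lam * expR t / (c * lam * expR t + al) -
            c * mu * expR t / (c * mu * expR t + be).
exists (d t0) => t Tt.
have pos (y : R) (r b : R) : 0 < r -> 0 <= b -> 0 < c * r * expR y + b.
  by move=> r0 b0'; rewrite ltr_wpDr// !mulr_gt0// expR_gt0.
have dexp (y r b : R) :
    is_derive y 1 (fun t => c * r * expR t + b) (c * r * expR y).
  have := is_derive_add (is_derive_scale (c * r) (is_derive_expR y))
      (is_derive_cst b y 1).
  by rewrite addr0.
have dpsi (y : R) : is_derive y 1
   (fun t => ln (c * lam * expR t + al) - ln (c * mu * expR t + be)) (d y).
  by apply: is_derive_sub; apply: is_derive_ln; rewrite ?pos //; exact: dexp.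
have psiE y : psi y = ln (c * lam * expR y + al) - ln (c * mu * expR y + be).
  by rewrite /psi ln_div // posrE pos.
suff : psi t0 - d t0 * t0 <= psi t - d t0 * t by rewrite mulrBr; lra.
rewrite !psiE.
have H := @ge_of_derive_sign R
  (fun t => ln (c * lam * expR t + al) - ln (c * mu * expR t + be) - d t0 * t)
  (fun t => d t - d t0) t0 t.
apply: H.
  move=> y _; apply: (is_derive_sub (dpsi y)).
  have := is_derive_scale (d t0) (is_derive_id y 1); by rewrite mulr1.
move=> y /andP[ym _].
have Ty : T < y by rewrite (le_lt_trans _ ym)// le_min !ltW.
have Tb : forall z w : R, T < z -> T < w ->
    al * be <= c ^+ 2 * lam * mu * (expR z * expR w).
  move=> z w Tz Tw; apply: le_trans ab _.
  rewrite ler_pM2l ?mulr_gt0 ?exprn_gt0 // expr2.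
  by rewrite ler_pM ?expR_ge0 // ler_expR ltW.
have [yt0|t0y] := leP y t0.
  rewrite mulr_le0 ?subr_le0//.
  by rewrite /d log_ratio_slope_mono ?expR_gt0 ?ler_expR ?Tb.
rewrite mulr_ge0 ?subr_ge0 ?(ltW t0y) //.
by rewrite /d log_ratio_slope_mono ?expR_gt0 ?ler_expR ?Tb ?(ltW t0y).
Qed.

End FixedSupport.

(** * One-sided second-order jets *)

Section Jets.
Context {R : realType}.

Lemma near_right0 (P : R -> Prop) : (\forall s \near 0^'+, P s) ->
  exists2 d : R, 0 < d & forall s, 0 < s -> s < d -> P s.
Proof.
case=> d /= d0 dP; exists d => // s s0 sd; apply: dP => //=.
by rewrite sub0r normrN gtr0_norm.
Qed.

Lemma cvg_near_eq (f g : R -> R) (l x : R) :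
  (\forall s \near x^'+, f s = g s) -> f s @[s --> x^'+] --> l ->
  g s @[s --> x^'+] --> l.
Proof.
move=> fg fl; apply: cvg_trans fl; apply: near_eq_cvg.
by apply: filterS fg => s /= ->.
Qed.

(** Only limits at 0 from the right are required, so that both halves of a curve
    through xi, the second one traversed backwards, have such a jet. *)
Definition right_C2_jet (e : R) (u du ddu : R -> R) (u1 u2 : R) :=
  [/\ forall s, s \in `]0, e[ -> is_derive s 1 u (du s),
      forall s, s \in `]0, e[ -> is_derive s 1 du (ddu s),
      u s @[s --> 0^'+] --> 0, du s @[s --> 0^'+] --> u1
    & ddu s @[s --> 0^'+] --> u2].

Lemma ge0_limit_right (f : R -> R) (e l : R) : 0 < e ->
  (forall s, 0 < s < e -> 0 <= f s) -> f s @[s --> 0^'+] --> l -> 0 <= l.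
Proof.
move=> e0 fge fl; rewrite leNgt; apply/negP => l0.
have : \forall s \near (0 : R)^'+, f s < 0 by exact: (cvgr_lt _ fl).
case/near_right0 => d d0 dP.
have m0 : 0 < Num.min d e by rewrite lt_min d0 e0.
have : Num.min d e / 2 < Num.min d e by rewrite ltr_pdivrMr // ltr_pMr // ltr1n.
rewrite lt_min => /andP[h1 h2].
have h0 : 0 < Num.min d e / 2 by rewrite divr_gt0.
have := dP _ h0 h1; have := fge (Num.min d e / 2); rewrite h0 h2 => /(_ isT).
by rewrite leNgt => /negP.
Qed.

Lemma right_C2_jet_quotient (e : R) (u du ddu : R -> R) (u1 u2 : R) : 0 < e ->
  right_C2_jet e u du ddu u1 u2 -> u s / s @[s --> 0^'+] --> u1.
Proof.
move=> e0 [H _ u0 du0 _].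
have := @cvg_div_exp_right R u du e u1 0%N e0 H u0.
rewrite divr1 => G; apply: G.
by under eq_fun do rewrite expr0 divr1.
Qed.

(** The sign of the first nonzero Taylor coefficient. *)
Lemma right_C2_jet_ge0 (e : R) (u du ddu : R -> R) (u1 u2 : R) : 0 < e ->
  right_C2_jet e u du ddu u1 u2 -> (forall s, 0 < s < e -> 0 <= u s) ->
  0 <= u1 /\ (u1 = 0 -> 0 <= u2).
Proof.
move=> e0 ju uge; split.
  apply: (ge0_limit_right e0 _ (right_C2_jet_quotient e0 ju)) => s /[dup] /uge us.
  by case/andP=> s0 _; rewrite divr_ge0 // ltW.
move=> u1E; case: ju => hu hdu u0 du0 ddu0.
have dus : du s / s @[s --> 0^'+] --> u2.
  have := @cvg_div_exp_right R du ddu e u2 0%N e0 hdu.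
  rewrite divr1 => G; apply: G; first by move: du0; rewrite u1E.
  by under eq_fun do rewrite expr0 divr1.
have us2 : u s / s ^+ 2 @[s --> 0^'+] --> u2 / 2.
  apply: (@cvg_div_exp_right R u du e _ 1%N e0 hu u0).
  by under eq_fun do rewrite expr1.
suff : 0 <= u2 / 2 by rewrite pmulr_lge0 // invr_gt0.
apply: (ge0_limit_right e0 _ us2) => s /[dup] /uge us.
by case/andP=> s0 _; rewrite divr_ge0 // exprn_ge0 // ltW.
Qed.

Lemma sign_mul_in_itv (e sg s : R) : sg = 1 \/ sg = -1 -> 0 < s < e ->
  sg * s \in `]- e, e[.
Proof.
move=> sg1 /andP[s0 se]; rewrite in_itv /=.
by case: sg1 => ->; rewrite ?mul1r ?mulN1r; apply/andP; split; lra.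
Qed.

End Jets.

(** * Exit points that tend to xi along a curved boundary arc *)

Section NearArc.
Context {R : realType}.

Context (e : R) (u v du dv ddu ddv : R -> R) (u1 v1 u2 v2 lam mu : R).
Context (e0 : 0 < e) (l0 : 0 < lam).
Context (ju : right_C2_jet e u du ddu u1 u2).
Context (jv : right_C2_jet e v dv ddv v1 v2).
Context (u10 : u1 < 0) (v10 : 0 < v1) (kap0 : 0 < v1 * u2 - u1 * v2).
Context (m10 : 0 <= lam * u1 + mu * v1).

Let cvu : u s / s @[s --> 0^'+] --> u1.
Proof. exact: right_C2_jet_quotient e0 ju. Qed.

Let cvv : v s / s @[s --> 0^'+] --> v1.
Proof. exact: right_C2_jet_quotient e0 jv. Qed.

(* N = ln (v / - u) has derivative D / (u * v), and the time
   t = ln (ell / m) has derivative dtau. *)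
Let D s := dv s * u s - du s * v s.
Let dD s := ddv s * u s - ddu s * v s.
Let m s := lam * u s + mu * v s.
Let dm s := lam * du s + mu * dv s.
Let ddm s := lam * ddu s + mu * ddv s.
Let ell s : R := 1 - u s - v s.
Let dell s := - (du s + dv s).
Let ddell s := - (ddu s + ddv s).

Let s_neq0 : \forall s \near (0 : R)^'+, s != 0.
Proof. by near=> s; rewrite gt_eqF. Unshelve. all: by end_near. Qed.

Let dDP s : s \in `]0, e[ -> is_derive s 1 D (dD s).
Proof.
move=> se; case: ju => /(_ s se) hu /(_ s se) hdu _ _ _.
case: jv => /(_ s se) hv /(_ s se) hdv _ _ _.
apply: (@is_derive_eq _ _ _ _ _ _ _ _
  (is_derive_sub (is_derive_mul hdv hu) (is_derive_mul hdu hv))).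
by rewrite /dD; ring.
Qed.

Let cv_id : (s : R) @[s --> 0^'+] --> (0 : R).
Proof. by apply: cvg_at_right_filter; exact: cvg_id. Qed.

Let cvdD : dD s / s @[s --> 0^'+] --> v2 * u1 - u2 * v1.
Proof.
case: ju => _ _ _ _ hu; case: jv => _ _ _ _ hv.
apply: cvg_near_eq; last exact: (cvgB (cvgM hv cvu) (cvgM hu cvv)).
by near=> s; rewrite /dD /= ?fctE /=; field; near: s.
Unshelve. all: by end_near. Qed.

Let cvD : D s / s ^+ 2 @[s --> 0^'+] --> (v2 * u1 - u2 * v1) / 2.
Proof.
apply: (@cvg_div_exp_right R D dD e _ 1%N e0 dDP).
  case: ju => _ _ hu hdu _; case: jv => _ _ hv hdv _.
  pose proof (cvgB (cvgM hdv hu) (cvgM hdu hv)) as HH; move: HH.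
  by rewrite !mulr0 subrr; exact.
by under eq_fun do rewrite expr1.
Qed.

(* the limit of N', positive by the curvature hypothesis *)
Let n1 := - (v1 * u2 - u1 * v2) / (2 * (u1 * v1)).

Let n1_gt0 : 0 < n1.
Proof.
by rewrite /n1 mulNr -mulrN -invrN divr_gt0 // -mulrN mulr_gt0 // oppr_gt0
  nmulr_rlt0.
Qed.

Let uv_neq0 : \forall s \near (0 : R)^'+, u s != 0 /\ v s != 0.
Proof.
have H1 := cvgr_lt _ cvu _ u10; have H2 := cvgr_gt _ cvv _ v10.
near=> s.
have s0 : 0 < s by near: s; exact: nbhs_right_gt.
split.
  suff: u s / s < 0 by rewrite pmulr_llt0 ?invr_gt0 // => /lt_eqF ->.
  by near: s; exact: H1.
suff: 0 < v s / s by rewrite pmulr_lgt0 ?invr_gt0 // => /gt_eqF ->.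
by near: s; exact: H2.
Unshelve. all: by end_near. Qed.

Let dN s := D s / (u s * v s).
Let ddN s := (dD s * (u s * v s) - D s * (du s * v s + u s * dv s)) /
             (u s * v s) ^+ 2.

Let uv1_neq0 : u1 * v1 != 0.
Proof. by rewrite mulf_neq0 // ?(lt_eqF u10) ?(gt_eqF v10). Qed.

Let cvdN : dN s @[s --> 0^'+] --> n1.
Proof.
have -> : n1 = (v2 * u1 - u2 * v1) / 2 / (u1 * v1).
  by rewrite /n1; field; rewrite !(lt_eqF u10) !(gt_eqF v10).
apply: cvg_near_eq; last exact: (cvgM cvD (cvgV uv1_neq0 (cvgM cvu cvv))).
near=> s; rewrite /dN /= ?fctE /=.
have [hu hv] : u s != 0 /\ v s != 0 by near: s.
by field; rewrite hu hv /=; near: s.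
Unshelve. all: by end_near. Qed.

Let cvddN : s * ddN s @[s --> 0^'+] --> 0.
Proof.
case: ju => _ _ _ hdu _; case: jv => _ _ _ hdv _.
have uv : (u s / s) * (v s / s) @[s --> 0^'+] --> u1 * v1.
  exact: cvgM cvu cvv.
pose proof (cvgB (cvgM cvdD (cvgV uv1_neq0 uv))
  (cvgM (cvgM cvD (cvgD (cvgM hdu cvv) (cvgM cvu hdv)))
     (cvgM (cvgV uv1_neq0 uv) (cvgV uv1_neq0 uv)))) as HH; move: HH.
set L := (X in _ --> X).
have -> : L = 0.
  by rewrite /L; field; rewrite !(lt_eqF u10) !(gt_eqF v10).
apply: cvg_near_eq.
near=> s; rewrite /ddN /= ?fctE /= ?fctE /=.
have [hu hv] : u s != 0 /\ v s != 0 by near: s.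
by field; rewrite hu hv /=; near: s.
Unshelve. all: by end_near. Qed.

(* m vanishes at 0 to the order k = 1 when lam * u1 + mu * v1 > 0, and k = 2 when
   the limiting chord is tangent to the arc, the curvature being what keeps m
   positive in the second case. *)
Let m_jet : exists2 k : R, 0 < k &
  [/\ s * dm s / m s @[s --> 0^'+] --> k,
      s ^+ 2 * ddm s / m s @[s --> 0^'+] --> k * (k - 1)
    & \forall s \near (0 : R)^'+, 0 < m s].
Proof.
case: (ju) => hu hdu cu cdu cddu; case: (jv) => hv hdv cv cdv cddv.
have cdm : dm s @[s --> 0^'+] --> lam * u1 + mu * v1.
  exact: (cvgD (cvgM (cvg_cst _) cdu) (cvgM (cvg_cst _) cdv)).
have cddm : ddm s @[s --> 0^'+] --> lam * u2 + mu * v2.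
  exact: (cvgD (cvgM (cvg_cst _) cddu) (cvgM (cvg_cst _) cddv)).
have cm : m s / s @[s --> 0^'+] --> lam * u1 + mu * v1.
  apply: cvg_near_eq; last first.
    exact: (cvgD (cvgM (cvg_cst lam) cvu) (cvgM (cvg_cst mu) cvv)).
  by near=> s; rewrite /m /= ?fctE /=; field; near: s.
have [m1E|m1p] := eqVneq (lam * u1 + mu * v1) 0; last first.
  have mp : 0 < lam * u1 + mu * v1 by rewrite lt_neqAle eq_sym m1p.
  have mgt : \forall s \near (0 : R)^'+, 0 < m s.
    have H := cvgr_gt _ cm _ mp; near=> s.
    have s0 : 0 < s by near: s; exact: nbhs_right_gt.
    suff: 0 < m s / s by rewrite pmulr_lgt0 ?invr_gt0.
    by near: s; exact: H.
  exists 1 => //; split => //.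
  - pose proof (cvgM cdm (cvgV m1p cm)) as HH; move: HH; rewrite divff //.
    apply: cvg_near_eq; near=> s; rewrite /= ?fctE /=.
    have s0 : s != 0 by near: s.
    have ms : m s != 0 by rewrite gt_eqF //; near: s.
    by field; rewrite ?s0 ?ms.
  - pose proof (cvgM cv_id (cvgM cddm (cvgV m1p cm))) as HH; move: HH.
    rewrite mul0r subrr mulr0.
    apply: cvg_near_eq; near=> s; rewrite /= ?fctE /=.
    have s0 : s != 0 by near: s.
    have ms : m s != 0 by rewrite gt_eqF //; near: s.
    by field; rewrite ?s0 ?ms.
have dmP s : s \in `]0, e[ -> is_derive s 1 m (dm s).
  by move=> se; exact: (is_derive_add (is_derive_scale lam (hu _ se))
    (is_derive_scale mu (hv _ se))).
have ddmP s : s \in `]0, e[ -> is_derive s 1 dm (ddm s).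
  by move=> se; exact: (is_derive_add (is_derive_scale lam (hdu _ se))
    (is_derive_scale mu (hdv _ se))).
have cdm1 : dm s / s @[s --> 0^'+] --> lam * u2 + mu * v2.
  have := @cvg_div_exp_right R dm ddm e (lam * u2 + mu * v2) 0%N e0 ddmP.
  rewrite divr1 => G; apply: G; first by move: cdm; rewrite m1E.
  by under eq_fun do rewrite expr0 divr1.
have cm2 : m s / s ^+ 2 @[s --> 0^'+] --> (lam * u2 + mu * v2) / 2.
  apply: (@cvg_div_exp_right R m dm e _ 1%N e0 dmP).
    pose proof (cvgD (cvgM (cvg_cst lam) cu) (cvgM (cvg_cst mu) cv)) as HH; move: HH.
    by rewrite !mulr0 addr0; exact.
  by under eq_fun do rewrite expr1.
have m2p : 0 < lam * u2 + mu * v2.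
  have E : v1 * (lam * u2 + mu * v2) = lam * (v1 * u2 - u1 * v2).
    have Z : v2 * (lam * u1 + mu * v1) = 0 by rewrite m1E mulr0.
    by rewrite -[RHS]addr0 -Z; ring.
  by rewrite -(pmulr_rgt0 _ v10) E mulr_gt0.
have m2n : (lam * u2 + mu * v2) / 2 != 0 by rewrite gt_eqF // divr_gt0.
have mgt : \forall s \near (0 : R)^'+, 0 < m s.
  have H : \forall s \near (0 : R)^'+, 0 < m s / s ^+ 2.
    by apply: (cvgr_gt _ cm2); rewrite divr_gt0.
  near=> s.
  have s0 : 0 < s by near: s; exact: nbhs_right_gt.
  suff: 0 < m s / s ^+ 2 by rewrite pmulr_lgt0 ?invr_gt0 ?exprn_gt0.
  by near: s; exact: H.
exists 2 => //; split => //.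
- pose proof (cvgM cdm1 (cvgV m2n cm2)) as HH; move: HH.
  have -> : (lam * u2 + mu * v2) * ((lam * u2 + mu * v2) / 2)^-1 = 2.
    by field; rewrite gt_eqF.
  apply: cvg_near_eq; near=> s; rewrite /= ?fctE /=.
  have s0 : s != 0 by near: s.
  have ms : m s != 0 by rewrite gt_eqF //; near: s.
  by field; rewrite ?s0 ?ms.
- pose proof (cvgM cddm (cvgV m2n cm2)) as HH; move: HH.
  have -> : (lam * u2 + mu * v2) * ((lam * u2 + mu * v2) / 2)^-1 = 2 * (2 - 1).
    by field; rewrite gt_eqF.
  apply: cvg_near_eq; near=> s; rewrite /= ?fctE /=.
  have s0 : s != 0 by near: s.
  have ms : m s != 0 by rewrite gt_eqF //; near: s.
  by field; rewrite ?s0 ?ms.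
Unshelve. all: by end_near. Qed.

Let dtau s := dell s / ell s - dm s / m s.
Let ddtau s := (ddell s * ell s - dell s * dell s) / ell s ^+ 2 -
               (ddm s * m s - dm s * dm s) / m s ^+ 2.

Let cvell : ell s @[s --> 0^'+] --> (1 : R).
Proof.
case: ju => _ _ cu _ _; case: jv => _ _ cv _ _.
pose proof (cvgB (cvgB (cvg_cst (1 : R)) cu) cv) as HH; move: HH.
by rewrite !subr0; exact.
Qed.

Let cvdell : dell s @[s --> 0^'+] --> - (u1 + v1).
Proof.
case: ju => _ _ _ cu _; case: jv => _ _ _ cv _.
exact: (cvgN (cvgD cu cv)).
Qed.

Let cvddell : ddell s @[s --> 0^'+] --> - (u2 + v2).
Proof.
case: ju => _ _ _ _ cu; case: jv => _ _ _ _ cv.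
exact: (cvgN (cvgD cu cv)).
Qed.

Let ell_gt0 : \forall s \near (0 : R)^'+, 0 < ell s.
Proof. exact: (cvgr_gt _ cvell _ ltr01). Qed.

Let ellV : (ell s)^-1 @[s --> 0^'+] --> (1 : R).
Proof. by rewrite -[X in _ --> X]invr1; apply: cvgV => //; exact: oner_neq0. Qed.

Let dtau_jet : exists2 k : R, 0 < k &
  s * dtau s @[s --> 0^'+] --> - k /\ s ^+ 2 * ddtau s @[s --> 0^'+] --> k.
Proof.
have [k k0 [cm1 cm2 mgt]] := m_jet; exists k => //; split.
  pose proof (cvgB (cvgM cv_id (cvgM cvdell ellV)) cm1) as HH; move: HH.
  rewrite mul0r sub0r; apply: cvg_near_eq.
  near=> s; rewrite /dtau /= ?fctE /=.
  have ms : m s != 0 by rewrite gt_eqF //; near: s.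
  have es : ell s != 0 by rewrite gt_eqF //; near: s.
  by field; rewrite ms es.
pose proof (cvgB (cvgM (cvgM cv_id cv_id)
   (cvgB (cvgM cvddell ellV) (cvgM (cvgM cvdell ellV) (cvgM cvdell ellV))))
   (cvgB cm2 (cvgM cm1 cm1))) as HH; move: HH.
set L := (X in _ --> X).
have -> : L = k by rewrite /L; ring.
apply: cvg_near_eq.
near=> s; rewrite /ddtau /= ?fctE /= ?fctE.
have ms : m s != 0 by rewrite gt_eqF //; near: s.
have es : ell s != 0 by rewrite gt_eqF //; near: s.
by field; rewrite ms es.
Unshelve. all: by end_near. Qed.

Let uv_sign : \forall s \near (0 : R)^'+, u s < 0 /\ 0 < v s.
Proof.
have H1 := cvgr_lt _ cvu _ u10; have H2 := cvgr_gt _ cvv _ v10.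
near=> s.
have s0 : 0 < s by near: s; exact: nbhs_right_gt.
split.
  suff: u s / s < 0 by rewrite pmulr_llt0 ?invr_gt0.
  by near: s; exact: H1.
suff: 0 < v s / s by rewrite pmulr_lgt0 ?invr_gt0.
by near: s; exact: H2.
Unshelve. all: by end_near. Qed.

(* s^2 * (N'' t' - N' t'') tends to - n1 * k *)
Let cross_lt0 : \forall s \near (0 : R)^'+,
  dtau s < 0 /\ ddN s * dtau s - dN s * ddtau s < 0.
Proof.
have [k k0 [c1 c2]] := dtau_jet.
have H1 : \forall s \near (0 : R)^'+, s * dtau s < 0.
  by apply: (cvgr_lt _ c1); rewrite oppr_lt0.
have H2 : \forall s \near (0 : R)^'+,
    (s * ddN s) * (s * dtau s) - dN s * (s ^+ 2 * ddtau s) < 0.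
  apply: (cvgr_lt _ (cvgB (cvgM cvddN c1) (cvgM cvdN c2))).
  by rewrite mul0r sub0r oppr_lt0 mulr_gt0.
near=> s.
have s0 : 0 < s by near: s; exact: nbhs_right_gt.
split.
  suff: s * dtau s < 0 by rewrite pmulr_rlt0.
  by near: s; exact: H1.
suff: s ^+ 2 * (ddN s * dtau s - dN s * ddtau s) < 0.
  by rewrite pmulr_rlt0 ?exprn_gt0.
have -> : s ^+ 2 * (ddN s * dtau s - dN s * ddtau s) =
  (s * ddN s) * (s * dtau s) - dN s * (s ^+ 2 * ddtau s) by ring.
by near: s; exact: H2.
Unshelve. all: by end_near. Qed.

(** The slope of N as a function of t is q = N' / t', which decreases with s while
    t decreases too; so N - q(s0) * t is minimal at s0. The last clause follows
    from the intermediate value theorem, since m tends to 0. *)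
Lemma arc_log_ratio_support_lines : exists (d T : R), [/\ 0 < d, d <= e,
  forall s, 0 < s < d -> [/\ u s < 0, 0 < v s, 0 < 1 - u s - v s
                           & 0 < lam * u s + mu * v s],
  forall s0, 0 < s0 < d -> exists k, forall s, 0 < s < d ->
    ln (v s0 / - u s0) + k *
      (ln ((1 - u s - v s) / (lam * u s + mu * v s)) -
       ln ((1 - u s0 - v s0) / (lam * u s0 + mu * v s0))) <=
    ln (v s / - u s)
  & forall t, T < t -> exists2 s, 0 < s < d &
    t = ln ((1 - u s - v s) / (lam * u s + mu * v s))].
Proof.
have [k k0 [_ _ mgt]] := m_jet.
have : \forall s \near (0 : R)^'+, [/\ s < e, u s < 0 /\ 0 < v s, 0 < ell s,
    0 < m s & dtau s < 0 /\ ddN s * dtau s - dN s * ddtau s < 0].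
  near=> s; split; near: s => //.
  exact: nbhs_right_lt.
case/near_right0 => d d0 dP.
have dle : d <= e.
  rewrite leNgt; apply/negP => ed.
  by have [] := dP e e0 ed; rewrite ltxx.
have sine s : 0 < s < d -> s \in `]0, e[.
  by move=> /andP[s0 sd]; rewrite in_itv /= s0 (lt_le_trans sd).
pose N s := ln (v s) - ln (- u s).
pose tau s := ln (ell s) - ln (m s).
have NE s : 0 < s < d -> ln (v s / - u s) = N s.
  move=> /andP[s0 sd]; have [_ [us vs] _ _ _] := dP _ s0 sd.
  by rewrite ln_div // posrE // oppr_gt0.
have tauE s : 0 < s < d -> ln ((1 - u s - v s) / (lam * u s + mu * v s)) = tau s.
  move=> /andP[s0 sd]; have [_ _ es ms _] := dP _ s0 sd.
  by rewrite -/(ell s) -/(m s) ln_div.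
have dellP s : 0 < s < d -> is_derive s 1 ell (dell s).
  move=> sd; case: ju => /(_ s (sine _ sd)) hu _ _ _ _.
  case: jv => /(_ s (sine _ sd)) hv _ _ _ _.
  apply: (@is_derive_eq _ _ _ _ _ _ _ _
    (is_derive_sub (is_derive_sub (is_derive_cst (1 : R) s 1) hu) hv)).
  by rewrite /dell; ring.
have ddellP s : 0 < s < d -> is_derive s 1 dell (ddell s).
  move=> sd; case: ju => _ /(_ s (sine _ sd)) hu _ _ _.
  case: jv => _ /(_ s (sine _ sd)) hv _ _ _.
  exact: (is_deriveN (is_derive_add hu hv)).
have dmP s : 0 < s < d -> is_derive s 1 m (dm s).
  move=> sd; case: ju => /(_ s (sine _ sd)) hu _ _ _ _.
  case: jv => /(_ s (sine _ sd)) hv _ _ _ _.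
  exact: (is_derive_add (is_derive_scale lam hu) (is_derive_scale mu hv)).
have ddmP s : 0 < s < d -> is_derive s 1 dm (ddm s).
  move=> sd; case: ju => _ /(_ s (sine _ sd)) hu _ _ _.
  case: jv => _ /(_ s (sine _ sd)) hv _ _ _.
  exact: (is_derive_add (is_derive_scale lam hu) (is_derive_scale mu hv)).
have dtauP s : 0 < s < d -> is_derive s 1 tau (dtau s).
  move=> /[dup] sd /andP[s0 sd']; have [_ _ es ms _] := dP _ s0 sd'.
  exact: (is_derive_sub (is_derive_ln es (dellP _ sd))
    (is_derive_ln ms (dmP _ sd))).
have ddtauP s : 0 < s < d -> is_derive s 1 dtau (ddtau s).
  move=> /[dup] sd /andP[s0 sd']; have [_ _ es ms _] := dP _ s0 sd'.
  have en : ell s != 0 by rewrite gt_eqF.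
  have mn : m s != 0 by rewrite gt_eqF.
  exact: (is_derive_sub (is_derive_div en (ddellP _ sd) (dellP _ sd))
    (is_derive_div mn (ddmP _ sd) (dmP _ sd))).
have dNP s : 0 < s < d -> is_derive s 1 N (dN s).
  move=> /[dup] sd /andP[s0 sd']; have [_ [us vs] _ _ _] := dP _ s0 sd'.
  have us' : 0 < - u s by rewrite oppr_gt0.
  case: ju => /(_ s (sine _ sd)) hu _ _ _ _.
  case: jv => /(_ s (sine _ sd)) hv _ _ _ _.
  have hnu : is_derive s 1 (fun s => - u s) (- du s) by exact: is_deriveN.
  apply: (@is_derive_eq _ _ _ _ _ _ _ _ (is_derive_sub (is_derive_ln vs hv)
    (@is_derive_ln _ (fun s => - u s) _ _ us' hnu))).
  by rewrite /dN /D; field; rewrite (gt_eqF vs) (lt_eqF us).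
have ddNP s : 0 < s < d -> is_derive s 1 dN (ddN s).
  move=> /[dup] sd /andP[s0 sd']; have [_ [us vs] _ _ _] := dP _ s0 sd'.
  have uvn : u s * v s != 0 by rewrite mulf_neq0 ?(gt_eqF vs) ?(lt_eqF us).
  case: ju => /(_ s (sine _ sd)) hu _ _ _ _.
  case: jv => /(_ s (sine _ sd)) hv _ _ _ _.
  exact: (@is_derive_div _ D (fun s => u s * v s) s _ _ uvn
    (dDP (sine _ sd)) (is_derive_mul hu hv)).
pose q s := dN s / dtau s.
have qP s : 0 < s < d ->
   is_derive s 1 q ((ddN s * dtau s - dN s * ddtau s) / dtau s ^+ 2).
  move=> /[dup] sd /andP[s0 sd']; have [_ _ _ _ [t0 _]] := dP _ s0 sd'.
  by apply: is_derive_div; [rewrite lt_eqF|exact: ddNP|exact: ddtauP].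
have q_decr a b : 0 < a -> b < d -> a < b -> q b <= q a.
  move=> a0 bd ab; rewrite -lerN2.
  apply: (@ge_of_derive_sign _ (fun s => - q s)
    (fun s => - ((ddN s * dtau s - dN s * ddtau s) / dtau s ^+ 2))).
    move=> y /andP[]; rewrite (min_idPl (ltW ab)) (max_idPr (ltW ab)) => ay yb.
    by apply: is_deriveN; apply: qP; rewrite (lt_le_trans a0)//= (le_lt_trans yb).
  move=> y /andP[]; rewrite (min_idPl (ltW ab)) (max_idPr (ltW ab)) => ay yb.
  have [_ _ _ _ [t0 t1]] := dP _ (lt_trans a0 ay) (lt_trans yb bd).
  rewrite mulr_ge0 ?subr_ge0 ?(ltW ay)// oppr_ge0 -oppr_ge0 -mulNr.
  by rewrite divr_ge0 ?sqr_ge0 // oppr_ge0 ltW.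
exists d, (tau (d / 2)); split => //.
- by move=> s /andP[s0 sd]; have [_ [us vs] es ms _] := dP _ s0 sd.
- move=> s0 hs0; exists (q s0) => s hs.
  rewrite !NE // !tauE //.
  suff : N s0 - q s0 * tau s0 <= N s - q s0 * tau s.
    move: (N s0) (q s0) (tau s0) (N s) (tau s) => x1 x2 x3 x4 x5.
    by rewrite mulrBr; lra.
  have inI y : Num.min s0 s <= y <= Num.max s0 s -> 0 < y < d.
    move: hs0 hs => /andP[a1 a2] /andP[b1 b2] /andP[h1 h2].
    by rewrite (lt_le_trans _ h1) ?lt_min ?a1 //= (le_lt_trans h2) // gt_max a2.
  apply: (@ge_of_derive_sign _ (fun s => N s - q s0 * tau s)
    (fun s => dN s - q s0 * dtau s)).
    move=> y /inI hy; apply: (is_derive_sub (dNP _ hy)).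
    exact: is_derive_scale (dtauP _ hy).
  move=> y hy; have /andP[y0 yd] : 0 < y < d.
    by apply: inI; case/andP: hy => h1 h2; rewrite !ltW.
  have [_ _ _ _ [ty _]] := dP _ y0 yd.
  have -> : dN y - q s0 * dtau y = (q y - q s0) * dtau y.
    by rewrite /q mulrBl mulfVK // lt_eqF.
  case/andP: hs0 => s00 s0d.
  have [ys|sy|->] := ltgtP y s0; last by rewrite !subrr mulr0.
    rewrite mulr_le0 ?subr_le0 ?(ltW ys)// mulr_ge0_le0 ?(ltW ty)//.
    by rewrite subr_ge0 q_decr.
  rewrite mulr_ge0 ?subr_ge0 ?(ltW sy)// mulr_le0 ?(ltW ty)//.
  by rewrite subr_le0 q_decr.
- move=> t tt.
  have d2 : 0 < d / 2 by rewrite divr_gt0.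
  have d2d : d / 2 < d by rewrite ltr_pdivrMr // ltr_pMr // ltr1n.
  have [a [a0 ad ta]] : exists a, [/\ 0 < a, a < d / 2 & t < tau a].
    have : \forall s \near (0 : R)^'+, 0 < ell s - expR t * m s.
      case: ju => _ _ cu _ _; case: jv => _ _ cv _ _.
      apply: (cvgr_gt _ (cvgB cvell (cvgM (cvg_cst (expR t))
        (cvgD (cvgM (cvg_cst lam) cu) (cvgM (cvg_cst mu) cv))))).
      by rewrite !mulr0 addr0 mulr0 subr0.
    case/near_right0 => r r0 rP.
    pose a := Num.min r (d / 2) / 2.
    have ar : a < Num.min r (d / 2).
      by rewrite /a ltr_pdivrMr // ltr_pMr ?ltr1n // lt_min r0.
    have a0 : 0 < a by rewrite divr_gt0 // lt_min r0.
    exists a; move: ar; rewrite lt_min => /andP[ar ad]; split => //.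
    have := rP a a0 ar; rewrite subr_gt0 => H.
    have [_ _ es ms _] := dP _ a0 (lt_trans ad d2d).
    rewrite /tau -ln_div ?posrE // -(expRK t) ltr_ln ?posrE ?expR_gt0 ?divr_gt0 //.
    by rewrite ltr_pdivlMr.
  have [] := @IVT R tau a (d / 2) t (ltW ad).
  + apply: (@within_cont_derive _ _ dtau) => y; rewrite in_itv /= => /andP[h1 h2].
    by apply: dtauP; rewrite (lt_le_trans a0) //= (le_lt_trans h2).
  + by rewrite ge_min le_max (ltW tt) (ltW ta) orbT.
  move=> c; rewrite in_itv /= => /andP[h1 h2] <-.
  have hc : 0 < c < d by rewrite (lt_le_trans a0) //= (le_lt_trans h2).
  by exists c => //; rewrite tauE.
Unshelve. all: by end_near. Qed.

End NearArc.

(** * Forms that vanish at exit points far from xi *)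

Section FarBounds.
Context {R : realType}.

(** In the coordinates (u, v) of xi + u (a - xi) + v (b - xi), an affine form has
    the value c + u (al - c) + v (be - c). The form considered here vanishes at
    the exit point, given by the parameter s > 1 at the time with exp t = E, and
    it is nonnegative at a boundary point w = (uw, vw). Since
    lam * uw + mu * vw < 0, the exit point is a combination of w and b whose
    coefficients are positive, with a ratio bounded below for large E. This
    bounds be by a multiple of c; as the exit point also stays away from xi,
    its equation then bounds al. *)
Lemma far_support_bounds (lam mu uw vw : R) : 0 < lam -> 0 < mu -> uw < 0 -> 0 < vw ->
  lam * uw + mu * vw < 0 ->
  exists E0 K, forall E s c al be : R, 0 < E -> E0 <= E -> 1 < s ->
    0 <= c -> 0 <= al -> 0 <= be -> 0 < c * mu * E + be ->
    0 <= c + uw * (al - c) + vw * (be - c) ->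
    c + (1 - s) / (1 + lam * E) * (al - c) + s / (1 + mu * E) * (be - c) = 0 ->
    [/\ 0 < c, al <= K * c & be <= K * c].
Proof.
move=> l0 m0 uw0 vw0 K0'.
pose K0 := - (lam * uw + mu * vw).
have K0p : 0 < K0 by rewrite oppr_gt0.
pose k1 := K0 / (2 * mu).
have k1p : 0 < k1 by rewrite divr_gt0 // mulr_gt0.
pose B := 1 + lam / mu.
have Bp : 0 < B by rewrite addr_gt0 // divr_gt0.
pose H := 2 * ((- uw)^-1 + B).
have nuw : 0 < - uw by rewrite oppr_gt0.
have Hp : 0 < H by rewrite mulr_gt0 // addr_gt0 // invr_gt0.
pose Kb := 1 + k1^-1.
have Kbp : 0 < Kb by rewrite addr_gt0 // invr_gt0.
pose Ka := 1 + H + Kb * (H + B).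
exists (mu^-1 + 2 * vw / K0), (Ka + Kb) => E s c al be E0 EE s1 c0 al0 be0 q0 Lw Lr.
have ef : 0 < 1 + lam * E by rewrite addr_gt0 // mulr_gt0.
have eg : 0 < 1 + mu * E by rewrite addr_gt0 // mulr_gt0.
(* the exit point is (- x, v) *)
pose x := - ((1 - s) / (1 + lam * E)).
pose v := s / (1 + mu * E).
have xp : 0 < x by rewrite /x -mulNr divr_gt0 // opprB subr_gt0.
have vp : 0 < v by rewrite divr_gt0 // (lt_trans ltr01).
have {}Lr : c - x * (al - c) + v * (be - c) = 0 by rewrite -Lr /x /v; ring.
(* its equation: it is aligned with the points of the two geodesics *)
have rel : v * (1 + mu * E) = 1 + x * (1 + lam * E).
  by rewrite /v /x; field; rewrite !gt_eqF.
pose th := (1 + mu * E)^-1.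
have thp : 0 < th by rewrite invr_gt0.
pose ra := (1 + lam * E) / (1 + mu * E).
have rap : 0 < ra by rewrite divr_gt0.
have vE : v = th + x * ra.
  rewrite /th /ra; apply: (mulIf (lt0r_neq0 eg)); rewrite rel.
  by field; rewrite gt_eqF.
have muE : mu^-1 <= E.
  by apply: le_trans EE; rewrite lerDl divr_ge0 ?ltW // mulr_gt0.
have mE1 : 1 <= mu * E by rewrite -(mulfV (lt0r_neq0 m0)) ler_pM2l.
have th2 : th <= 2^-1 by rewrite lef_pV2 ?posrE //; lra.
have raB : ra <= B.
  rewrite /ra /B ler_pdivrMr //.
  have -> : (1 + lam / mu) * (1 + mu * E) = 1 + lam * E + (mu * E + lam / mu).
    by field; rewrite gt_eqF.
  by rewrite lerDl addr_ge0 ?divr_ge0 ?mulr_ge0 // ltW.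
have rak : vw + k1 <= - uw * ra.
  have EK : K0 / mu + 2 * vw <= K0 * E.
    have := ler_wpM2l (ltW K0p) EE; apply: le_trans.
    by rewrite mulrDr mulrCA mulfV ?lt0r_neq0 // mulr1.
  rewrite /ra mulrA ler_pdivlMr //.
  have k1m : k1 * mu = K0 / 2 by rewrite /k1; field; rewrite gt_eqF.
  have k12 : k1 = (K0 / mu) / 2 by rewrite /k1; field; rewrite gt_eqF.
  have -> : (vw + k1) * (1 + mu * E) = vw + k1 + vw * mu * E + (k1 * mu) * E.
    by ring.
  have K0E : K0 * E = - uw * (lam * E) - vw * mu * E by rewrite /K0; ring.
  rewrite k1m mulrDr mulr1; lra.
(* the exit point is r1 * w + rho * (0, 1) *)
pose r1 := x / - uw.
have r1p : 0 < r1 by rewrite divr_gt0.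
pose rho := v - r1 * vw.
have xE : x = r1 * - uw by rewrite /r1 divfK // gt_eqF.
have rhok : k1 * r1 <= rho.
  rewrite /rho vE; have := ler_wpM2l (ltW r1p) rak.
  have -> : r1 * (- uw * ra) = x * ra by rewrite mulrA -xE.
  lra.
have rhop : 0 < rho by rewrite (lt_le_trans _ rhok) // mulr_gt0.
pose Lwv := c + uw * (al - c) + vw * (be - c).
have key : c * (r1 + rho - 1) = r1 * Lwv + rho * be.
  have -> : c * (r1 + rho - 1) = c * (r1 + rho - 1) +
      (c - x * (al - c) + v * (be - c)) by rewrite Lr addr0.
  by rewrite /rho xE /Lwv; ring.
have r1Lw : 0 <= r1 * Lwv by rewrite mulr_ge0 // ltW.
have rb0 : 0 <= rho * be by rewrite mulr_ge0 // ltW.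
have cp : 0 < c.
  rewrite lt_neqAle c0 andbT; apply/eqP => cE.
  move: key; rewrite -cE mul0r => key.
  have : rho * be = 0 by lra.
  move/eqP; rewrite mulf_eq0 gt_eqF //= => /eqP beE.
  by move: q0; rewrite -cE beE !mul0r addr0 ltxx.
have rr1 : 1 <= r1 + rho.
  have : 0 <= c * (r1 + rho - 1) by rewrite key addr_ge0.
  by rewrite pmulr_rge0 // subr_ge0.
have beK : be <= Kb * c.
  rewrite -(ler_pM2l rhop).
  have h1 : rho * be <= c * (r1 + rho) by lra.
  apply: (le_trans h1).
  have h2 : r1 <= k1^-1 * rho by rewrite ler_pdivlMl.
  have := ler_wpM2l (ltW cp) h2; rewrite /Kb; lra.
have xH : 1 <= H * x.
  have h1 : rho <= v by rewrite /rho gerBl mulr_ge0 // ltW.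
  have h2 : x * ra <= x * B by rewrite ler_wpM2l // ltW.
  have h3 : r1 = (- uw)^-1 * x by rewrite /r1 mulrC.
  have : 2^-1 <= ((- uw)^-1 + B) * x by rewrite mulrDl -h3; lra.
  by rewrite /H; lra.
have vx : v <= (H + B) * x.
  rewrite vE mulrDl; apply: lerD; last by rewrite mulrC ler_wpM2r // ltW.
  by lra.
have alK : al <= Ka * c.
  rewrite -(ler_pM2l xp).
  have h1 : x * al = x * c + c + v * (be - c) by lra.
  have h2 : v * (be - c) <= v * (Kb * c) by rewrite ler_wpM2l ?(ltW vp) //; lra.
  have Kc : 0 <= Kb * c by rewrite mulr_ge0 // ltW.
  have h3 : v * (Kb * c) <= (H + B) * x * (Kb * c) by rewrite ler_wpM2r.
  have h4 : c <= H * x * c by rewrite ler_peMl // ltW.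
  rewrite h1 /Ka; lra.
have Kap : 0 < Ka by rewrite !addr_gt0 // mulr_gt0 // addr_gt0.
split => //; rewrite mulrDl.
  by rewrite (le_trans alK) // lerDl mulr_ge0 // ltW.
by rewrite (le_trans beK) // lerDr mulr_ge0 // ltW.
Qed.

End FarBounds.

(** * Segments, exit points and the Funk distance *)

Section DotProduct.
Context {R : realType} {n : nat}.
Implicit Types (w x y p q z : 'rV[R]_n) (s t : R).

Lemma dotvD w x y : dotv w (x + y) = dotv w x + dotv w y.
Proof.
by rewrite /dotv -big_split; apply: eq_bigr => i _; rewrite mxE mulrDr.
Qed.

Lemma dotvZ w s x : dotv w (s *: x) = s * dotv w x.
Proof. by rewrite /dotv mulr_sumr; apply: eq_bigr => i _; rewrite mxE mulrCA. Qed.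

Lemma dotvN w x : dotv w (- x) = - dotv w x.
Proof. by rewrite -scaleN1r dotvZ mulN1r. Qed.

Lemma dotv0 w : dotv w 0 = 0.
Proof. by rewrite -(scale0r (0 : 'rV[R]_n)) dotvZ mul0r. Qed.

Lemma dotvB w x y : dotv w (x - y) = dotv w x - dotv w y.
Proof. by rewrite dotvD dotvN. Qed.

Lemma dotvC x y : dotv x y = dotv y x.
Proof. by apply: eq_bigr => i _; rewrite mulrC. Qed.

Lemma dotvNl w x : dotv (- w) x = - dotv w x.
Proof. by rewrite dotvC dotvN dotvC. Qed.

Lemma dotv_ge0 x : 0 <= dotv x x.
Proof. by apply: sumr_ge0 => i _; rewrite -expr2 sqr_ge0. Qed.

Lemma dotv_eq0 x : (dotv x x == 0) = (x == 0).
Proof.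
apply/eqP/eqP => [x0|->]; last by rewrite /dotv big1 // => i _; rewrite mxE mul0r.
apply/rowP => j; rewrite mxE; apply/eqP; rewrite -sqrf_eq0 expr2; apply/eqP.
apply: (psumr_eq0P _ x0) => // i _; by rewrite -expr2 sqr_ge0.
Qed.

Lemma enorm_gt0 x : x != 0 -> 0 < enorm x.
Proof. by move=> x0; rewrite sqrtr_gt0 lt_neqAle eq_sym dotv_eq0 x0 dotv_ge0. Qed.

Lemma enormZ s x : enorm (s *: x) = `|s| * enorm x.
Proof.
rewrite /enorm dotvZ dotvC dotvZ mulrA -expr2 sqrtrM ?sqr_ge0 //.
by rewrite sqrtr_sqr.
Qed.

Lemma dotv_continuous w : continuous (dotv w : 'rV[R]_n -> R^o).
Proof.
apply: (@continuous_big R^o _ +%R 0 xpredT) => [|i _ x].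
  by move=> x; exact: (@add_continuous R^o x).
exact: (cvgM (cvg_cst _) (@coord_continuous R 1 n ord0 i x)).
Qed.

End DotProduct.

Section ConvexGeometry.
Context {R : realType} {n : nat}.
Implicit Types (Omega : set 'rV[R]_n) (w x y p q r z : 'rV[R]_n) (s t : R).

Lemma convex_segment Omega x y t : convex_set Omega -> Omega x -> Omega y ->
  0 <= t -> t <= 1 -> Omega (x + t *: (y - x)).
Proof.
move=> cO Ox Oy t0 t1.
have := cO y x (Itv01 t0 t1); rewrite !inE => /(_ Oy Ox).
rewrite /conv /=.
suff -> : x + t *: (y - x) = t *: y + (1 - t) *: x by [].
by apply/rowP => j; rewrite !mxE; ring.
Qed.

Lemma line_continuous p z :
  continuous ((fun s => p + s *: z) : R^o -> 'rV[R]_n).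
Proof.
move=> s; apply: cvgD; first exact: cvg_cst.
by apply: cvgZ; [exact: cvg_id | exact: cvg_cst].
Qed.

(** With w = z + t (y - z), the homothety phi of center w that sends z to y sends
    some point x of Omega near z into Omega, and w lies between x and phi x. *)
Lemma closure_segment Omega z y t : open Omega -> convex_set Omega ->
  closure Omega z -> Omega y -> 0 < t -> t <= 1 -> Omega (z + t *: (y - z)).
Proof.
move=> oO cO clz Oy t0 t1.
set w := z + _.
pose phi x : 'rV[R]_n := t^-1 *: (w - (1 - t) *: x).
have phiz : phi z = y.
  apply/rowP => j; rewrite !mxE; field; exact: lt0r_neq0.
have cphi : {for z, continuous phi}.
  exact: (cvgZ (cvg_cst _) (cvgB (cvg_cst _) (cvgZ (cvg_cst _) cvg_id))).
have nz : nbhs z (phi @^-1` Omega).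
  by apply: cphi; rewrite phiz; apply: open_nbhs_nbhs.
have [x [Ox /= Opx]] := clz _ nz.
have -> : w = x + t *: (phi x - x).
  apply/rowP => j; rewrite !mxE; field; exact: lt0r_neq0.
by apply: convex_segment => //; exact: ltW.
Qed.

Lemma open_boundaryE Omega z : open Omega ->
  boundary Omega z <-> closure Omega z /\ ~ Omega z.
Proof.
by move=> oO; rewrite /boundary (interior_id Omega).1.
Qed.

Definition exits Omega p q s := 1 < s /\ boundary Omega (p + s *: (q - p)).

Lemma ray_boundary_uniq Omega p z s1 s2 : open Omega -> convex_set Omega ->
  Omega p -> 0 < s1 -> 0 < s2 ->
  boundary Omega (p + s1 *: z) -> boundary Omega (p + s2 *: z) -> s1 = s2.
Proof.
move=> oO cO Op.
wlog lt12 : s1 s2 / s1 < s2.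
  move=> H h1 h2 b1 b2; have [l|l|//] := ltgtP s1 s2; first exact: H.
  by apply/esym; exact: H.
move=> s10 s20 /open_boundaryE -/(_ oO) [_ b1].
move=> /open_boundaryE -/(_ oO) [c2 _]; exfalso; apply: b1.
have -> : p + s1 *: z =
   (p + s2 *: z) + (1 - s1 / s2) *: (p - (p + s2 *: z)).
  apply/rowP => j; rewrite !mxE; field; exact: lt0r_neq0.
apply: closure_segment => //.
  by rewrite subr_gt0 ltr_pdivrMr // mul1r.
by rewrite gerBl divr_ge0 // ltW.
Qed.

Lemma ray_boundary_exists Omega p z : open Omega -> convex_set Omega ->
  bounded_set Omega -> Omega p -> z != 0 ->
  exists2 s, 0 < s & boundary Omega (p + s *: z).
Proof.
move=> oO cO [M [Mr bO]] Op z0.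
pose E : set R := [set s | 0 <= s /\ Omega (p + s *: z)].
have E0 : E 0 by split => //; rewrite scale0r addr0.
have nz : 0 < `|z| by rewrite normr_gt0.
have ubE : has_ubound E.
  exists ((M + 1 + `|p|) / `|z|) => s [s0 Os]; rewrite ler_pdivlMr //.
  have := bO (M + 1); rewrite ltrDl ltr01 => /(_ isT _ Os) /= H.
  rewrite -(ger0_norm s0) -normrZ.
  have -> : s *: z = (p + s *: z) - p by rewrite addrAC subrr add0r.
  by apply: (le_trans (ler_normB _ _)); rewrite lerD2r.
have hsE : has_sup E by split => //; exists 0.
pose s := sup E.
have s0 : 0 <= s by exact: (ub_le_sup ubE).
have near_line (r0 : R) (U : set 'rV[R]_n) : nbhs (p + r0 *: z) U ->
    exists2 d : R, 0 < d & forall s', `|r0 - s'| < d -> U (p + s' *: z).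
  move=> /(line_continuous (p := p) (z := z)).
  by case=> d /= d0 dU; exists d => // s' /dU.
have Os : ~ Omega (p + s *: z).
  move=> Os; have [d d0 dU] := near_line s Omega (open_nbhs_nbhs (conj oO Os)).
  have : s + d / 2 <= s.
    apply: (ub_le_sup ubE); split; first by rewrite addr_ge0 // divr_ge0 // ltW.
    apply: dU; rewrite opprD addNKr normrN gtr0_norm ?divr_gt0 //.
    by rewrite ltr_pdivrMr // ltr_pMr // ltr1n.
  by rewrite gerDl leNgt divr_gt0.
exists s.
  rewrite lt_neqAle s0 andbT; apply/eqP => s00; apply: Os.
  by rewrite -s00 scale0r addr0.
apply/open_boundaryE => //; split => // U /near_line[d d0 dU].
have [s' [s'0 Os'] s's] := sup_adherent d0 hsE.
exists (p + s' *: z); split => //; apply: dU.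
rewrite ger0_norm ?subr_ge0; last by apply: (ub_le_sup ubE).
by rewrite ltrBlDl -ltrBlDr.
Qed.

Lemma exits_exists Omega p q : open Omega -> convex_set Omega ->
  bounded_set Omega -> Omega p -> Omega q -> p != q -> exists s, exits Omega p q s.
Proof.
move=> oO cO bO Op Oq pq.
have qp : q - p != 0 by rewrite subr_eq0 eq_sym.
have [s s0 bs] := ray_boundary_exists oO cO bO Op qp.
exists s; split => //; rewrite ltNge; apply/negP => s1.
have /open_boundaryE -/(_ oO) [_] := bs; apply.
by apply: convex_segment => //; exact: ltW.
Qed.

Lemma exits_uniq Omega p q s1 s2 : open Omega -> convex_set Omega ->
  Omega p -> exits Omega p q s1 -> exits Omega p q s2 -> s1 = s2.
Proof.
move=> oO cO Op [h1 b1] [h2 b2].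
by apply: (ray_boundary_uniq oO cO Op _ _ b1 b2); rewrite (lt_trans ltr01).
Qed.

(** The Funk metric: only the end of the chord beyond q enters. With
    p' = p + s (q - p) the exit point, s / (s - 1) = |p' - p| / |p' - q|. *)
Definition funk Omega p q : R :=
  let s := xget 0 [set s | exits Omega p q s] in ln (s / (s - 1)).

Lemma funkE Omega p q s : open Omega -> convex_set Omega -> Omega p ->
  exits Omega p q s -> funk Omega p q = ln (s / (s - 1)).
Proof.
move=> oO cO Op es; rewrite /funk (@xget_unique _ _ _ s) //.
by move=> s' es'; exact: exits_uniq es' es.
Qed.

Lemma hilbert_funk Omega p q : open Omega -> convex_set Omega ->
  bounded_set Omega -> Omega p -> Omega q -> p != q ->
  hilbert Omega p q = funk Omega p q + funk Omega q p.
Proof.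
move=> oO cO bO Op Oq pq.
have [s2 e2] := exits_exists oO cO bO Op Oq pq.
have [s1 e1] : exists s, exits Omega q p s by apply: exits_exists => //; rewrite eq_sym.
have EP : forall p q s, Omega p -> exits Omega p q s ->
    exit_point Omega p q = p + s *: (q - p).
  move=> {p q Op Oq pq s2 e2 s1 e1} p q s Op [s1 bs]; apply: xget_unique => /=.
    by split => //; exists s.
  move=> y [by_ [s' s'1 yE]]; rewrite yE; congr (_ + _ *: _).
  apply: (exits_uniq oO cO Op _ (conj s1 bs)).
  by split; [exact: s'1 | rewrite -yE].
rewrite (funkE oO cO Op e2) (funkE oO cO Oq e1).
rewrite /hilbert (negPf pq) (EP _ _ _ Op e2) (EP _ _ _ Oq e1).
case: e1 e2 => s11 _ [s21 _].
have -> : q + s1 *: (p - q) - q = s1 *: (p - q) by rewrite addrAC subrr add0r.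
have -> : p + s2 *: (q - p) - p = s2 *: (q - p) by rewrite addrAC subrr add0r.
have -> : q + s1 *: (p - q) - p = (s1 - 1) *: (p - q).
  by apply/rowP => j; rewrite !mxE; ring.
have -> : p + s2 *: (q - p) - q = (s2 - 1) *: (q - p).
  by apply/rowP => j; rewrite !mxE; ring.
rewrite !enormZ.
have n1 : 0 < enorm (p - q) by rewrite enorm_gt0 // subr_eq0.
have n2 : 0 < enorm (q - p) by rewrite enorm_gt0 // subr_eq0 eq_sym.
have a1 : 0 < s1 by lra.
have a2 : 0 < s2 by lra.
have b1 : 0 < s1 - 1 by lra.
have b2 : 0 < s2 - 1 by lra.
rewrite !gtr0_norm // -lnM ?posrE ?divr_gt0 //; congr ln.
by field; rewrite !gt_eqF.
Qed.

End ConvexGeometry.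

(** * Supporting forms *)

Section Supports.
Context {R : realType} {n : nat}.
Implicit Types (Omega : set 'rV[R]_n) (w x y p q r z : 'rV[R]_n) (s t : R).

(** An affine form is encoded by its gradient w and one of its zeros r; when r is
    a boundary point, the forms below define the supporting half-spaces at r. *)
Definition supports Omega w r := forall z, Omega z -> 0 < dotv w (z - r).

Lemma dotv_line w r p q s :
  dotv w (p + s *: (q - p) - r) =
  dotv w (p - r) + s * (dotv w (q - r) - dotv w (p - r)).
Proof. by rewrite !(dotvB, dotvD, dotvZ); ring. Qed.

Lemma supports_closure Omega w r z y : open Omega -> convex_set Omega ->
  supports Omega w r -> Omega y -> closure Omega z -> 0 <= dotv w (z - r).
Proof.
move=> oO cO sw Oy cz; rewrite leNgt; apply/negP => wz0.
have wy := sw _ Oy.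
set a := dotv w (z - r) in wz0; set b := dotv w (y - r) in wy.
have ba : 0 < b - a by lra.
pose t := - a / (b - a).
have t0 : 0 < t by rewrite divr_gt0 // oppr_gt0.
have t1 : t <= 1 by rewrite ler_pdivrMr // mul1r; lra.
have := sw _ (closure_segment oO cO cz Oy t0 t1).
by rewrite dotv_line -/a -/b /t divfK ?gt_eqF // subrr ltxx.
Qed.

(** The form is nonnegative at the exit point, and affine on the ray. *)
Lemma funk_ge_support Omega w r p q s : open Omega -> convex_set Omega ->
  supports Omega w r -> Omega p -> Omega q -> exits Omega p q s ->
  ln (dotv w (p - r) / dotv w (q - r)) <= funk Omega p q.
Proof.
move=> oO cO sw Op Oq es; rewrite (funkE oO cO Op es).
case: es => s1 /open_boundaryE -/(_ oO) [cz _].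
have := supports_closure oO cO sw Op cz; rewrite dotv_line.
have := sw _ Op; have := sw _ Oq.
move: (dotv w (p - r)) (dotv w (q - r)) => a b b0 a0 H.
have s10 : 0 < s - 1 by lra.
rewrite ler_ln ?posrE ?divr_gt0 //; last by lra.
rewrite ler_pdivlMr // mulrAC ler_pdivrMr //.
lra.
Qed.

Lemma funk_eq_support Omega w r p q s : open Omega -> convex_set Omega ->
  supports Omega w r -> Omega p -> Omega q -> exits Omega p q s ->
  dotv w (p + s *: (q - p) - r) = 0 ->
  funk Omega p q = ln (dotv w (p - r) / dotv w (q - r)).
Proof.
move=> oO cO sw Op Oq es; rewrite (funkE oO cO Op es) dotv_line.
case: es => s1 _.
have := sw _ Op; have := sw _ Oq.
move: (dotv w (p - r)) (dotv w (q - r)) => a b b0 a0 H.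
have n1 : s - 1 != 0 by rewrite gt_eqF // subr_gt0.
have n2 : b != 0 by rewrite gt_eqF.
by congr ln; apply/eqP; rewrite eqr_div //; apply/eqP; lra.
Qed.

End Supports.

Section SupportsExist.
Context {R : realType} {n : nat}.
Implicit Types (Omega : set 'rV[R]_n) (w x y p q r z xi a b : 'rV[R]_n).
Implicit Types (s t lam mu : R).

(** A point of the closure at which no facet form vanishes is interior. *)
Lemma polytope_supports k (nrm : 'I_k -> 'rV[R]_n) (off : 'I_k -> R) r :
  let Q := \bigcap_(i in [set: 'I_k]) halfspace (nrm i) (off i) in
  (forall i, nrm i != 0) -> boundary (interior Q) r ->
  exists2 i, dotv (nrm i) r = off i & supports (interior Q) (- nrm i) r.
Proof.
move=> Q nrm0 [cr nr].
have Qc i z : Q z -> dotv (nrm i) z <= off i by move=> /(_ i I).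
have iQ i z : interior Q z -> dotv (nrm i) z < off i.
  move=> Qz.
  have : nbhs (0 : R) [set t | Q (z + t *: nrm i)].
    by apply: (line_continuous (p := z) (z := nrm i)); rewrite scale0r addr0.
  case=> d /= d0 dQ.
  have d2 : 0 < d / 2 by rewrite divr_gt0.
  have : Q (z + (d / 2) *: nrm i).
    apply: dQ => /=; rewrite sub0r normrN gtr0_norm //.
    by rewrite ltr_pdivrMr // ltr_pMr // ltr1n.
  move=> /(Qc i); rewrite dotvD dotvZ; apply: lt_le_trans.
  by rewrite ltrDl mulr_gt0 // lt_neqAle eq_sym dotv_eq0 nrm0 dotv_ge0.
have Qr i : dotv (nrm i) r <= off i.
  rewrite leNgt; apply/negP => H.
  have : \forall z \near r, off i < dotv (nrm i) z.
    exact: (cvgr_gt _ (@dotv_continuous R n (nrm i) r) _ H).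
  by move=> /cr[z [Qz /=]]; have := iQ i z Qz; lra.
have [[i ri]|H] := pselect (exists i, dotv (nrm i) r = off i).
  exists i => // z /(iQ i); rewrite dotvNl dotvB ri; lra.
exfalso; apply: nr.
have Hlt i : dotv (nrm i) r < off i.
  by rewrite lt_neqAle Qr andbT; apply/eqP => E; apply: H; exists i.
apply: nbhs_interior.
have : \forall z \near r, forall i, dotv (nrm i) z < off i.
  apply: (@filter_forall _ _ (fun i z => is_true (dotv (nrm i) z < off i)) _ (nbhs_filter r)) => i.
  exact: (cvgr_lt _ (@dotv_continuous R n (nrm i) r) _ (Hlt i)).
by apply: filterS => z Hz i _; exact: ltW.
Qed.

Lemma linear_dotv (l : {linear 'rV[R]_n -> R^o}) :
  exists w, forall v, l v = dotv w v.
Proof.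
exists (\row_j l (delta_mx ord0 j)) => v.
rewrite [in LHS](row_sum_delta v) linear_sum; apply: eq_bigr => j _.
by rewrite linearZ mxE /GRing.scale /= mulrC.
Qed.

(** The differential at r of a defining function F is nonpositive in the direction
    of each point z of Omega, since F < 0 on the segment from z to r; it is
    negative because Omega is open and the differential is not zero. *)
Lemma C2_boundary_supports Omega r : open Omega -> convex_set Omega ->
  C2_boundary Omega -> boundary Omega r -> exists w, supports Omega w r.
Proof.
move=> oO cO C2 /[dup] br /C2[U [F [[oU Ur] [[dF _] _] [v0 Fv0] OU]]].
move: br => /open_boundaryE -/(_ oO)[cr nOr].
have dFr := dF r Ur.
have [w wE] := linear_dotv ('d F r).
have DE v : 'D_v F r = dotv w v by rewrite deriveE // wE.
have Fr : 0 <= F r.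
  rewrite leNgt; apply/negP => Fr0; apply: nOr.
  have : (Omega `&` U) r by rewrite OU; split.
  by case.
have Dle z : Omega z -> dotv w (z - r) <= 0.
  move=> Oz; rewrite -DE leNgt; apply/negP => D0.
  have dv : derivable F r (z - r) by exact: diff_derivable.
  have H1 := cvgr_gt _ dv _ D0.
  have H2 : nbhs (0 : R) [set t | U (r + t *: (z - r))].
    apply: (line_continuous (p := r) (z := z - r)); rewrite scale0r addr0.
    exact: open_nbhs_nbhs.
  case: H1 => d1 /= d10 H1; case: H2 => d2 /= d20 H2.
  pose t := Num.min (Num.min d1 d2) 1 / 2.
  have m0 : 0 < Num.min (Num.min d1 d2) 1 by rewrite !lt_min d10 d20 ltr01.
  have t0 : 0 < t by rewrite divr_gt0.
  have : t < Num.min (Num.min d1 d2) 1.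
    by rewrite /t ltr_pdivrMr // ltr_pMr // ltr1n.
  rewrite !lt_min => /andP[/andP[td1 td2] t1].
  have := H1 t; rewrite /= sub0r normrN gtr0_norm // => /(_ td1).
  rewrite gt_eqF // => /(_ isT).
  rewrite /= [t *: (z - r) + r]addrC.
  have Ot : Omega (r + t *: (z - r)) by apply: closure_segment => //; exact: ltW.
  have Ut : U (r + t *: (z - r)).
    by apply: H2 => /=; rewrite sub0r normrN gtr0_norm.
  have : ([set y | F y < 0] `&` U) (r + t *: (z - r)) by rewrite -OU; split.
  case=> /= Ft _.
  rewrite /GRing.scale /= pmulr_rgt0 ?invr_gt0 // subr_gt0 => FF.
  by have := lt_trans FF Ft; rewrite ltNge Fr.
exists (- w) => z Oz; rewrite dotvNl oppr_gt0 lt_neqAle Dle // andbT.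
apply/eqP => E.
have : nbhs (0 : R) [set t | Omega (z + t *: v0)].
  apply: (line_continuous (p := z) (z := v0)); rewrite scale0r addr0.
  exact: open_nbhs_nbhs.
case=> d /= d0 dO.
have step t : `|t| < d -> t * dotv w v0 <= 0.
  move=> td; have := Dle (z + t *: v0); rewrite addrAC dotvD dotvZ E add0r.
  by apply; apply: dO => /=; rewrite sub0r normrN.
have d2 : 0 < d / 2 by rewrite divr_gt0.
have d2d : d / 2 < d by rewrite ltr_pdivrMr // ltr_pMr // ltr1n.
have := step (d / 2); rewrite gtr0_norm // => /(_ d2d).
have := step (- (d / 2)); rewrite normrN gtr0_norm // => /(_ d2d).
rewrite mulNr oppr_le0 => h1 h2.
have /eqP : d / 2 * dotv w v0 = 0 by apply/eqP; rewrite eq_le h1 h2.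
rewrite mulf_eq0 (gt_eqF d2) /= -DE => /eqP E0.
by move: Fv0; rewrite E0 eqxx.
Qed.

End SupportsExist.

(** * Parametrization of geodesic lines *)

Section Geodesics.
Context {R : realType} {n : nat}.
Implicit Types (Omega : set 'rV[R]_n) (w x y p q r z : 'rV[R]_n) (s t : R).

Lemma line_isometry (W : R -> R) :
  (forall s t, `|W s - W t| = `|s - t|) ->
  (forall t, W t = W 0 + t) \/ (forall t, W t = W 0 - t).
Proof.
move=> H.
have H0 t : W t - W 0 = t \/ W t - W 0 = - t.
  have := H t 0; rewrite subr0 => /eqP.
  rewrite eqr_norml normr_ge0 andbT => /orP[]/eqP ->.
    by case: (ler0P t) => _; [right|left].
  by case: (ler0P t) => _; [left|right]; rewrite ?opprK.
have [H1|H1] := H0 1; [left|right] => t; have [Ht|Ht] := H0 t; try lra.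
- have := H t 1.
  have -> : W t - W 1 = - t - 1 by lra.
  move=> /eqP; rewrite -(eqrXn2 (n := 2)) // !real_normK ?num_real // => /eqP.
  by rewrite !expr2; lra.
- have := H t 1.
  have -> : W t - W 1 = t + 1 by lra.
  move=> /eqP; rewrite -(eqrXn2 (n := 2)) // !real_normK ?num_real // => /eqP.
  by rewrite !expr2; lra.
Qed.

Lemma cvg_inv_expR (lam : R) : 0 < lam ->
  (1 + lam * expR t)^-1 @[t --> +oo] --> (0 : R).
Proof.
move=> l0; apply/cvgrPdist_lt => e e0.
exists (Num.max 0 (ln (e^-1 / lam))); split; first by rewrite num_real.
move=> t; rewrite gt_max => /andP[t0 te] /=.
have d0 : 0 < 1 + lam * expR t by rewrite addr_gt0 // mulr_gt0 // expR_gt0.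
rewrite sub0r normrN gtr0_norm ?invr_gt0 //.
rewrite -(invrK e) ltf_pV2 ?posrE ?invr_gt0 //.
have ie : 0 < e^-1 / lam by rewrite divr_gt0 // invr_gt0.
have : e^-1 / lam < expR t by rewrite -(lnK ie) ltr_expR.
by rewrite ltr_pdivrMr // mulrC => H; rewrite (lt_trans H) // ltrDr.
Qed.

(** With f t = f 0 + k t * v and endpoints f 0 + sp * v and f 0 - sm * v, the
    function W = ln ((k + sm) / (sp - k)) is an isometry from the line to itself,
    hence equal to t or - t up to a constant; the endpoint reached at +oo is xi. *)
Lemma geodesic_lineE Omega f xi : open Omega -> convex_set Omega ->
  bounded_set Omega -> geodesic_line Omega f -> f t @[t --> +oo] --> xi ->
  exists a lam, [/\ 0 < lam, boundary Omega a, a != xi &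
    forall t, f t = xi + (1 + lam * expR t)^-1 *: (a - xi)].
Proof.
move=> oO cO bO [fO fh [L [z0 [M [rM ->]]] fL]] fxi.
have fM t : (f t - z0 <= M)%MS.
  have : range f (f t) by exists t.
  by rewrite fL => -[].
set v := f 1 - f 0.
have f01 : f 0 != f 1.
  apply/eqP => E; have := fh 0 1; rewrite /hilbert E eqxx sub0r normrN normr1.
  by move=> /eqP; rewrite eq_sym oner_eq0.
have v0 : v != 0 by rewrite subr_eq0 eq_sym.
have subM s t : (f s - f t <= M)%MS.
  have -> : f s - f t = (f s - z0) - (f t - z0).
    by rewrite opprB addrA subrK.
  by rewrite addmx_sub // eqmx_opp.
have Mv : (M <= v)%MS.
  have [_] := mxrank_leqif_sup (subM 1 0); rewrite -/v => <-.
  by rewrite rM rank_rV v0.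
have /choice[k kE] : forall t, exists k, f t = f 0 + k *: v.
  move=> t; have /sub_rVP[k kE] := submx_trans (subM t 0) Mv.
  by exists k; rewrite -kE addrC subrK.
have [sp sp0 bp] := ray_boundary_exists oO cO bO (fO 0) v0.
have nv0 : - v != 0 by rewrite oppr_eq0.
have [sm sm0 bm] := ray_boundary_exists oO cO bO (fO 0) nv0.
have kp t : k t < sp.
  rewrite ltNge; apply/negP => spk.
  have /open_boundaryE -/(_ oO) [_] := bp; apply.
  have kt0 : 0 < k t by rewrite (lt_le_trans sp0).
  have -> : f 0 + sp *: v = f 0 + (sp / k t) *: (f t - f 0).
    rewrite (kE t) [f 0 + k t *: v]addrC addrK scalerA divfK //; exact: lt0r_neq0.
  apply: convex_segment => //; first by rewrite divr_ge0 // ltW.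
  by rewrite ler_pdivrMr // mul1r.
have km t : - sm < k t.
  rewrite ltNge; apply/negP => spk.
  have /open_boundaryE -/(_ oO) [_] := bm; apply.
  have kt0 : 0 < - k t by lra.
  have -> : f 0 + sm *: - v = f 0 + (sm / - k t) *: (f t - f 0).
    rewrite (kE t) [f 0 + k t *: v]addrC addrK scalerA scalerN -scaleNr.
    by congr (_ + _ *: _); field; rewrite -oppr_eq0 gt_eqF.
  apply: convex_segment => //; first by rewrite divr_ge0 // ltW.
  by rewrite ler_pdivrMr //; lra.
have A t : 0 < k t + sm by have := km t; lra.
have B t : 0 < sp - k t by have := kp t; lra.
pose W t := ln ((k t + sm) / (sp - k t)).
have hlt s t : k s < k t -> hilbert Omega (f s) (f t) = W t - W s /\
                           hilbert Omega (f t) (f s) = W t - W s.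
  move=> kst.
  have st : f s != f t.
    apply/eqP => E; move: kst; rewrite lt_neqAle => /andP[/eqP + _]; apply.
    have : k s *: v = k t *: v by apply: (@addrI _ (f 0)); rewrite -!kE.
    move/eqP; rewrite -subr_eq0 -scalerBl scaler_eq0 (negPf v0) orbF subr_eq0.
    by move/eqP.
  have kd : 0 < k t - k s by lra.
  have e1 : exits Omega (f s) (f t) ((sp - k s) / (k t - k s)).
    split; first by rewrite ltr_pdivlMr // mul1r; have := kp t; lra.
    rewrite [X in boundary _ X](_ : _ = f 0 + sp *: v) //.
    rewrite (kE s) (kE t); move: (f 0) => z.
    by apply/rowP => j; rewrite !mxE; field; rewrite gt_eqF.
  have e2 : exits Omega (f t) (f s) ((k t + sm) / (k t - k s)).
    split; first by rewrite ltr_pdivlMr // mul1r; have := km s; lra.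
    rewrite [X in boundary _ X](_ : _ = f 0 + sm *: - v) //.
    rewrite (kE s) (kE t); move: (f 0) => z.
    by apply/rowP => j; rewrite !mxE; field; rewrite gt_eqF.
  rewrite !hilbert_funk //; last by rewrite eq_sym.
  rewrite (funkE oO cO (fO s) e1) (funkE oO cO (fO t) e2).
  suff E : ln ((sp - k s) / (k t - k s) / ((sp - k s) / (k t - k s) - 1)) +
    ln ((k t + sm) / (k t - k s) / ((k t + sm) / (k t - k s) - 1)) = W t - W s.
    by split => //; rewrite addrC.
  have frac (x d : R) : d != 0 -> x - d != 0 -> x / d / (x / d - 1) = x / (x - d).
    by move=> d0 xd; field; rewrite xd d0.
  have := B t; have := B s; have := A t; have := A s => As At Bs Bt.
  have e1' : sp - k s - (k t - k s) = sp - k t by ring.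
  have e2' : k t + sm - (k t - k s) = k s + sm by ring.
  rewrite !frac ?(lt0r_neq0 kd) ?e1' ?e2' ?lt0r_neq0 //.
  rewrite /W !ln_div ?posrE //; ring.
have WP s t : `|W s - W t| = `|s - t|.
  have [ks|ks|ks] := ltgtP (k s) (k t).
  - have [h _] := hlt _ _ ks; move: (fh s t); rewrite h => E.
    by rewrite distrC E normr_id.
  - have [_ h] := hlt _ _ ks; move: (fh s t); rewrite h => E.
    by rewrite E normr_id.
  - have -> : W s = W t by rewrite /W ks.
    by rewrite -(fh s t) subrr normr0 /hilbert (kE s) (kE t) ks eqxx.
have Wexp t : (k t + sm) / (sp - k t) = expR (W t).
  by rewrite lnK // posrE divr_gt0.
have finish e1 e2 lam : 0 < lam -> boundary Omega e1 -> boundary Omega e2 ->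
    (forall t, f t = e1 + (1 + lam * expR t)^-1 *: (e2 - e1)) ->
    exists a lam, [/\ 0 < lam, boundary Omega a, a != xi &
      forall t, f t = xi + (1 + lam * expR t)^-1 *: (a - xi)].
  move=> lam0 b1 b2 fE.
  have fe1 : f t @[t --> +oo] --> e1.
    have -> : f = fun t => e1 + (1 + lam * expR t)^-1 *: (e2 - e1).
      by apply/funext.
    have H := cvgD (cvg_cst e1) (cvgZ (cvg_inv_expR lam0) (cvg_cst (e2 - e1))).
    by move: H; rewrite scale0r addr0; exact.
  have xiE : xi = e1 by exact: (cvg_unique _ fxi fe1).
  exists e2, lam; split => //; last by rewrite xiE.
  apply/eqP => E; move: f01; rewrite !fE E xiE subrr !scaler0.
  by rewrite eqxx.
have lam0 := expR_gt0 (W 0).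
case: (line_isometry WP) => WE.
- apply: (finish (f 0 + sp *: v) (f 0 + sm *: - v) (expR (W 0))) => // t.
  have E : k t + sm = expR (W 0) * expR t * (sp - k t).
    by rewrite -expRD -WE -Wexp divfK // lt0r_neq0.
  have d0 : 0 < 1 + expR (W 0) * expR t.
    by rewrite addr_gt0 // mulr_gt0 // expR_gt0.
  have kk : k t = (expR (W 0) * expR t * sp - sm) / (1 + expR (W 0) * expR t).
    by apply: (mulIf (lt0r_neq0 d0)); rewrite divfK ?gt_eqF //; lra.
  rewrite (kE t) kk; move: (f 0) => z.
  by apply/rowP => j; rewrite !mxE; field; rewrite gt_eqF.
- have lam1 := expR_gt0 (- W 0).
  apply: (finish (f 0 + sm *: - v) (f 0 + sp *: v) (expR (- W 0))) => // t.
  set g := expR (- W 0) * expR t.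
  have g0 : 0 < g by rewrite mulr_gt0 // expR_gt0.
  have gV : g = (expR (W t))^-1.
    by rewrite /g -expRD -expRN (WE t); congr expR; ring.
  have E : sp - k t = g * (k t + sm).
    by rewrite gV -Wexp invf_div divfK // lt0r_neq0.
  have d0 : 0 < 1 + g by rewrite addr_gt0.
  have kk : k t = (sp - g * sm) / (1 + g).
    by apply: (mulIf (lt0r_neq0 d0)); rewrite divfK ?gt_eqF //; lra.
  rewrite (kE t) kk; move: (f 0) => z.
  by apply/rowP => j; rewrite !mxE; field; rewrite gt_eqF.
Qed.

End Geodesics.

(** * Boundary curves parametrized by arc length *)

Section Curves.
Context {R : realType} {n : nat}.
Implicit Types (w x y z xi A B : 'rV[R]_n).

Lemma is_derive_dotv w (G : R^o -> 'rV[R]_n) (s : R) : derivable G s 1 ->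
  is_derive s 1 (fun s => dotv w (G s)) (dotv w ('D_1 G s)).
Proof.
move=> dG; have /derivable_mxP dGi := dG.
have H : is_derive (s : R^o) 1 (\sum_(i < n) (fun s : R^o => w ord0 i * G s ord0 i))
   (\sum_(i < n) w ord0 i * ('D_1 (fun s => G s ord0 i) s : R^o)).
  apply: is_derive_sum => i.
  apply: is_derive_scale; exact: derivableP (dGi ord0 i).
have -> : (fun s => dotv w (G s)) =
    \sum_(i < n) (fun s : R^o => w ord0 i * G s ord0 i).
  by apply/funext => x; rewrite fct_sumE.
apply: is_derive_eq H _; apply: eq_bigr => i _.
by rewrite derive_mx // mxE.
Qed.

Lemma is_derive_dotv_self (G : R^o -> 'rV[R]_n) (s : R) : derivable G s 1 ->
  is_derive s 1 (fun s => dotv (G s) (G s)) (2 * dotv (G s) ('D_1 G s)).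
Proof.
move=> dG; have /derivable_mxP dGi := dG.
have H : is_derive (s : R^o) 1
   (\sum_(i < n) (fun s : R^o => G s ord0 i * G s ord0 i))
   (\sum_(i < n) ('D_1 (fun s => G s ord0 i) s * G s ord0 i +
                  G s ord0 i * ('D_1 (fun s => G s ord0 i) s : R^o))).
  apply: is_derive_sum => i.
  apply: is_derive_mul; exact: derivableP (dGi ord0 i).
have -> : (fun s => dotv (G s) (G s)) =
    \sum_(i < n) (fun s : R^o => G s ord0 i * G s ord0 i).
  by apply/funext => x; rewrite fct_sumE.
apply: is_derive_eq H _; rewrite mulr_sumr; apply: eq_bigr => i _.
by rewrite derive_mx // mxE; ring.
Qed.

Lemma derive_cst_itv (f : R -> R) (e k s df : R) : s \in `]- e, e[ ->
  (forall s, s \in `]- e, e[ -> f s = k) -> is_derive s 1 f df -> df = 0.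
Proof.
move=> se fk fdf.
have fc : \forall s' \near s, cst k s' = f s'.
  by have := near_in_itvoo se; apply: filterS => s' /fk ->.
have dc : is_derive s 1 (cst k : R -> R) df.
  apply: (@near_eq_is_derive _ _ _ f) fdf.
  by apply: filterS fc => s' ->.
by case: dc => _ <-; rewrite derive_cst.
Qed.

Context (e : R) (gamma : R^o -> 'rV[R]_n) (xi : 'rV[R]_n).
Context (e0 : 0 < e) (g0 : gamma 0 = xi) (gC2 : C2_on `]- e, e[%classic gamma).

Let in0 : (0 : R) \in `]- e, e[.
Proof. by rewrite in_itv /= oppr_lt0 e0. Qed.

Let dg (s : R) : s \in `]- e, e[ -> derivable gamma s 1.
Proof. by move=> se; apply: diff_derivable; apply: gC2.1.1. Qed.

Let ddg (s : R) : s \in `]- e, e[ -> derivable ('D_1 gamma) s 1.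
Proof. by move=> se; apply: diff_derivable; apply: (gC2.2 1).1. Qed.

Let cddg : {for 0, continuous ('D_1 ('D_1 gamma))}.
Proof. exact: (gC2.2 1).2. Qed.

Lemma curve_right_C2_jet w (sg : R) : sg = 1 \/ sg = -1 ->
  right_C2_jet e (fun s => dotv w (gamma (sg * s) - xi))
    (fun s => sg * dotv w ('D_1 gamma (sg * s)))
    (fun s => dotv w ('D_1 ('D_1 gamma) (sg * s)))
    (sg * dotv w ('D_1 gamma 0)) (dotv w ('D_1 ('D_1 gamma) 0)).
Proof.
move=> sg1.
have sg2 : sg * sg = 1 by case: sg1 => ->; rewrite ?mulr1 // mulrNN mulr1.
have sge s : s \in `]0, e[ -> sg * s \in `]- e, e[.
  by rewrite in_itv /=; exact: sign_mul_in_itv.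
have dsg (s : R) : is_derive s 1 (fun s : R => sg * s) sg.
  by have := is_derive_scale sg (is_derive_id s 1); rewrite mulr1.
have cont w' (G : R^o -> 'rV[R]_n) : {for 0, continuous G} ->
    dotv w' (G (sg * s)) @[s --> 0^'+] --> dotv w' (G 0).
  move=> cG; apply: cvg_at_right_filter.
  have c1 : sg * s @[s --> (0 : R)] --> (0 : R).
    have := is_derive_cont (dsg 0); rewrite /prop_for /continuous_at.
    by rewrite mulr0.
  have c2 := cvg_comp _ _ c1 cG.
  exact: (cvg_comp _ _ c2 (@dotv_continuous R n w' (G 0))).
have cG (G : R^o -> 'rV[R]_n) (s : R) : derivable G s 1 -> {for s, continuous G}.
  by move=> /derivable1_diffP /differentiable_continuous.
split.
- move=> s /sge sgs.
  have := is_derive1_comp (is_derive_dotv w (dg sgs)) (dsg s).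
  rewrite mulrC => H.
  have -> : (fun s => dotv w (gamma (sg * s) - xi)) =
     (fun s => ((fun s => dotv w (gamma s)) \o (fun s => sg * s)) s - dotv w xi).
    by apply/funext => x; rewrite dotvB.
  have := is_derive_sub H (is_derive_cst (dotv w xi) s 1); by rewrite subr0.
- move=> s /sge sgs.
  have := is_derive1_comp (is_derive_dotv w (ddg sgs)) (dsg s).
  move=> /(is_derive_scale sg).
  by rewrite mulrCA sg2 mulr1.
- have := cont w gamma (cG _ _ (dg in0)); rewrite g0 => H.
  have := cvgB H (cvg_cst (dotv w xi)); rewrite subrr => {}H.
  by under eq_fun do rewrite dotvB; exact: H.
- have H := cont w ('D_1 gamma) (cG _ _ (ddg in0)).
  exact: cvgM (cvg_cst sg) H.
- exact: cont w _ cddg.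
Qed.

(** A linear relation satisfied by the curve passes to its derivatives; with it the
    coordinates of the curve in its plane become those of its derivatives. *)
Lemma curve_annihilator w : (forall s, s \in `]- e, e[ -> dotv w (gamma s - xi) = 0) ->
  dotv w ('D_1 gamma 0) = 0 /\ dotv w ('D_1 ('D_1 gamma) 0) = 0.
Proof.
move=> H.
have H1 s : s \in `]- e, e[ -> dotv w ('D_1 gamma s) = 0.
  move=> se; apply: (derive_cst_itv (f := fun s => dotv w (gamma s))
    (k := dotv w xi) se _ (is_derive_dotv w (dg se))) => s' /H.
  by rewrite dotvB => /eqP; rewrite subr_eq0 => /eqP.
split; first exact: H1.
exact: (derive_cst_itv in0 H1 (is_derive_dotv w (ddg in0))).
Qed.

Lemma unit_speed_orthogonal :
  (forall s, s \in `]- e, e[ -> enorm ('D_1 gamma s) = 1) ->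
  dotv ('D_1 gamma 0) ('D_1 gamma 0) = 1 /\
  dotv ('D_1 gamma 0) ('D_1 ('D_1 gamma) 0) = 0.
Proof.
move=> H.
have H1 s : s \in `]- e, e[ -> dotv ('D_1 gamma s) ('D_1 gamma s) = 1.
  by move=> /H; rewrite /enorm => E; rewrite -[LHS]sqr_sqrtr ?dotv_ge0 // E expr1n.
split; first exact: H1.
have := derive_cst_itv in0 H1 (is_derive_dotv_self (ddg in0)).
by move=> /eqP; rewrite mulf_eq0 pnatr_eq0 /= => /eqP.
Qed.

End Curves.

(** * The Funk distance along two asymptotic geodesics *)

Section AsymptoticPair.
Context {R : realType} {n : nat}.
Implicit Types (Omega : set 'rV[R]_n) (w x y p q r z xi a b : 'rV[R]_n).
Implicit Types (s t lam mu : R).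

Definition asymptote xi a lam t : 'rV[R]_n :=
  xi + (1 + lam * expR t)^-1 *: (a - xi).

(** The added term makes the ratio of two forms at the two points independent of
    the denominators 1 + lam * exp t and 1 + mu * exp t; it changes sign when the
    two geodesics are exchanged. *)
Definition relfunk Omega xi a b lam mu t : R :=
  funk Omega (asymptote xi a lam t) (asymptote xi b mu t) +
  ln ((1 + lam * expR t) / (1 + mu * expR t)).

Lemma one_add_expR_gt0 lam t : 0 < lam -> 0 < 1 + lam * expR t.
Proof. by move=> l0; rewrite addr_gt0 // mulr_gt0 // expR_gt0. Qed.

Lemma dotv_asymptote w r xi a lam t : 0 < lam ->
  dotv w (asymptote xi a lam t - r) =
  (dotv w (xi - r) * lam * expR t + dotv w (a - r)) / (1 + lam * expR t).
Proof.
move=> l0; rewrite /asymptote dotv_line.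
have := one_add_expR_gt0 t l0; move=> h.
by field; rewrite gt_eqF.
Qed.

Context (Omega : set 'rV[R]_n) (oO : open Omega) (cO : convex_set Omega).
Context (bO : bounded_set Omega) (xi a b : 'rV[R]_n) (lam mu : R).
Context (bxi : boundary Omega xi) (ba : boundary Omega a) (bb : boundary Omega b).
Context (l0 : 0 < lam) (m0 : 0 < mu).
Context (Op : forall t, Omega (asymptote xi a lam t)).
Context (Oq : forall t, Omega (asymptote xi b mu t)).
Context (pq : forall t, asymptote xi a lam t != asymptote xi b mu t).

Notation p := (asymptote xi a lam).
Notation q := (asymptote xi b mu).
Notation N := (relfunk Omega xi a b lam mu).

Lemma support_asymptote_ge0 w r : supports Omega w r ->
  [/\ 0 <= dotv w (xi - r), 0 <= dotv w (a - r), 0 <= dotv w (b - r),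
    forall t, 0 < dotv w (xi - r) * lam * expR t + dotv w (a - r)
  & forall t, 0 < dotv w (xi - r) * mu * expR t + dotv w (b - r)].
Proof.
move=> sw.
have cl z : boundary Omega z -> 0 <= dotv w (z - r).
  by move=> /open_boundaryE -/(_ oO) [cz _]; exact: (supports_closure oO cO sw (Op 0) cz).
split; [exact: cl|exact: cl|exact: cl| |] => t.
  have := sw _ (Op t); rewrite dotv_asymptote // pmulr_lgt0 //.
  by rewrite invr_gt0 one_add_expR_gt0.
have := sw _ (Oq t); rewrite dotv_asymptote // pmulr_lgt0 //.
by rewrite invr_gt0 one_add_expR_gt0.
Qed.

Lemma support_log_ratio w r t : supports Omega w r ->
  ln ((dotv w (xi - r) * lam * expR t + dotv w (a - r)) /
      (dotv w (xi - r) * mu * expR t + dotv w (b - r))) =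
  ln (dotv w (p t - r) / dotv w (q t - r)) +
  ln ((1 + lam * expR t) / (1 + mu * expR t)).
Proof.
move=> sw; have [_ _ _ /(_ t) h1 /(_ t) h2] := support_asymptote_ge0 sw.
rewrite !dotv_asymptote //.
have := one_add_expR_gt0 t l0; have := one_add_expR_gt0 t m0 => h3 h4.
rewrite -lnM ?posrE ?divr_gt0 //; congr ln.
by field; rewrite !gt_eqF.
Qed.

Lemma relfunk_ge_support w r t : supports Omega w r ->
  ln ((dotv w (xi - r) * lam * expR t + dotv w (a - r)) /
      (dotv w (xi - r) * mu * expR t + dotv w (b - r))) <= N t.
Proof.
move=> sw; rewrite support_log_ratio // lerD2r.
have [s es] := exits_exists oO cO bO (Op t) (Oq t) (pq t).
exact: (funk_ge_support oO cO sw (Op t) (Oq t) es).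
Qed.

Lemma relfunk_eq_support w t s : exits Omega (p t) (q t) s ->
  let r := p t + s *: (q t - p t) in supports Omega w r ->
  N t = ln ((dotv w (xi - r) * lam * expR t + dotv w (a - r)) /
      (dotv w (xi - r) * mu * expR t + dotv w (b - r))).
Proof.
move=> es r sw; rewrite support_log_ratio //; congr (_ + _).
apply: (funk_eq_support oO cO sw (Op t) (Oq t) es).
by rewrite subrr dotv0.
Qed.

(** The form wb, which vanishes at b, bounds exp (relfunk) below by lam / mu, so
    the form that realizes relfunk at t has a ratio at least lam / mu. *)
Lemma exit_support_order w wb t s : supports Omega wb b ->
  exits Omega (p t) (q t) s ->
  let r := p t + s *: (q t - p t) in supports Omega w r ->
  lam * dotv w (b - r) <= mu * dotv w (a - r).
Proof.
move=> swb es r sw.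
have := relfunk_ge_support t swb; rewrite (relfunk_eq_support es sw).
have [c0 a0 b0 /(_ t) A1 /(_ t) B1] := support_asymptote_ge0 sw.
have [c0' a0' b0' /(_ t) A2 /(_ t) B2] := support_asymptote_ge0 swb.
have E0 := expR_gt0 t.
rewrite ler_ln ?posrE ?divr_gt0 //.
move: A1 B1 A2 B2.
have -> : dotv wb (b - b) = 0.
  by rewrite subrr dotv0.
rewrite -/r !addr0.
move: (dotv w (xi - r)) (dotv w (a - r)) (dotv w (b - r)) c0 a0 b0.
move: (dotv wb (xi - b)) (dotv wb (a - b)) c0' a0'.
move: (expR t) E0 => E E0 c' al' c'0 al'0 c al be c0 al0 be0 A1 B1 A2 B2 H.
have : lam / mu <= (c * lam * E + al) / (c * mu * E + be).
  apply: le_trans H; rewrite ler_pdivlMr // mulrAC ler_pdivrMr //.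
  have : 0 <= al' * mu by rewrite mulr_ge0 // ltW.
  lra.
rewrite ler_pdivlMr // mulrAC ler_pdivrMr //; lra.
Qed.

Lemma relfunk_support_line (T : R) : (exists wb, supports Omega wb b) ->
  (forall t s, T < t -> exits Omega (p t) (q t) s ->
    let r := p t + s *: (q t - p t) in
    exists2 w, supports Omega w r &
     (dotv w (xi - r) = 0 \/ 0 < dotv w (xi - r) /\
      dotv w (a - r) * dotv w (b - r) <=
      dotv w (xi - r) ^+ 2 * lam * mu * expR T ^+ 2)) ->
  forall t0, T < t0 ->
    exists k, forall t, T < t -> N t0 + k * (t - t0) <= N t.
Proof.
move=> [wb swb] H t0 Tt0.
have [s es] := exits_exists oO cO bO (Op t0) (Oq t0) (pq t0).
have [w sw cond] := H _ _ Tt0 es.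
have [c0 a0 b0 _ _] := support_asymptote_ge0 sw.
have [k hk] := log_ratio_support_line l0 m0 c0 a0 b0
   (exit_support_order swb es sw) cond Tt0.
exists k => t Tt; rewrite (relfunk_eq_support es sw).
exact: le_trans (hk _ Tt) (relfunk_ge_support t sw).
Qed.

(* a crude bound that turns a constant into a threshold for the time *)
Lemma expR_sq_ge (T x : R) : 0 <= T -> x <= T -> x <= expR T ^+ 2.
Proof.
move=> T0 xT; have h := expR_ge1Dx T.
rewrite expr2; have e1 : 1 <= expR T by lra.
have := ler_wpM2l (expR_ge0 T) e1; lra.
Qed.

Lemma polytope_relfunk_support_line k (nrm : 'I_k -> 'rV[R]_n) (off : 'I_k -> R) :
  (forall i, nrm i != 0) ->
  Omega = interior (\bigcap_(i in [set: 'I_k]) halfspace (nrm i) (off i)) ->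
  eventually_support_lines N.
Proof.
move=> nrm0 OE.
have sup r : boundary Omega r ->
    exists2 i, dotv (nrm i) r = off i & supports Omega (- nrm i) r.
  by rewrite OE; exact: polytope_supports.
pose C i := off i - dotv (nrm i) xi.
pose A i := off i - dotv (nrm i) a.
pose B i := off i - dotv (nrm i) b.
pose X i := A i * B i / (C i ^+ 2 * lam * mu).
pose T := 1 + \sum_i `|X i|.
have T0 : 0 < T by rewrite ltr_wpDr // sumr_ge0.
exists T => //.
apply: relfunk_support_line.
  by have [i _ si] := sup _ bb; exists (- nrm i).
move=> t s Tt es r; have [i ri si] := sup _ es.2.
exists (- nrm i) => //.
have [c0 a0 b0 _ _] := support_asymptote_ge0 si.
have EC z : dotv (- nrm i) (z - r) = off i - dotv (nrm i) z.
  by rewrite dotvNl dotvB ri opprB.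
rewrite !EC -/(C i) -/(A i) -/(B i) in c0 *.
have [->|Cn] := eqVneq (C i) 0; first by left.
right; have Cp : 0 < C i by rewrite lt_neqAle eq_sym Cn c0.
split => //.
have XT : X i <= expR T ^+ 2.
  apply: expR_sq_ge; first exact: ltW.
  rewrite /T (bigD1 i) //=.
  have := ler_norm (X i).
  have : 0 <= \sum_(j < k | j != i) `|X j| by rewrite sumr_ge0.
  lra.
have D0 : 0 < C i ^+ 2 * lam * mu by rewrite !mulr_gt0.
have -> : A i * B i = X i * (C i ^+ 2 * lam * mu) by rewrite divfK // gt_eqF.
by rewrite mulrC ler_pM2l.
Qed.

(** The condition on (uw, vw) says that the limiting chord leaves xi on the inner
    side of the segment from xi to this boundary point. *)
Lemma far_relfunk_support_line (uw vw : R) :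
  (forall r, boundary Omega r -> exists w, supports Omega w r) ->
  uw < 0 -> 0 < vw -> lam * uw + mu * vw < 0 ->
  boundary Omega (xi + uw *: (a - xi) + vw *: (b - xi)) ->
  eventually_support_lines N.
Proof.
move=> sup uw0 vw0 uvw bw.
have [E0 [K HK]] := far_support_bounds l0 m0 uw0 vw0 uvw.
pose T := 1 + `|E0| + `|K ^+ 2 / (lam * mu)|.
have T0 : 0 < T.
  have := normr_ge0 E0; have := normr_ge0 (K ^+ 2 / (lam * mu)).
  by rewrite /T; lra.
exists T => //.
apply: relfunk_support_line; first exact: sup.
move=> t s Tt es r; have [w sw] := sup _ es.2.
exists w => //; right.
have [c0 a0 b0 _ /(_ t) q0] := support_asymptote_ge0 sw.
have dE u v : dotv w (xi + u *: (a - xi) + v *: (b - xi) - r) =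
  dotv w (xi - r) + u * (dotv w (a - r) - dotv w (xi - r)) +
                    v * (dotv w (b - r) - dotv w (xi - r)).
  by rewrite !(dotvB, dotvD, dotvZ); ring.
have Lw : 0 <= dotv w (xi + uw *: (a - xi) + vw *: (b - xi) - r).
  have /open_boundaryE -/(_ oO) [cw _] := bw.
  exact: (supports_closure oO cO sw (Op 0) cw).
rewrite dE in Lw.
have rE : r = xi + ((1 - s) / (1 + lam * expR t)) *: (a - xi) +
                   (s / (1 + mu * expR t)) *: (b - xi).
  by apply/rowP => j; rewrite !mxE; ring.
have Lr : dotv w (r - r) = 0.
  by rewrite subrr dotv0.
rewrite {1}rE dE in Lr.
have EE : E0 <= expR t.
  have := expR_ge1Dx t; have := ler_norm E0.
  have : 0 <= `|K ^+ 2 / (lam * mu)| by [].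
  by move: Tt; rewrite /T; lra.
have [cp aK bK] := HK _ _ _ _ _ (expR_gt0 t) EE es.1 c0 a0 b0 q0 Lw Lr.
split => //.
have D0 : 0 < lam * mu by rewrite mulr_gt0.
have XT : K ^+ 2 / (lam * mu) <= expR T ^+ 2.
  apply: expR_sq_ge; first exact: ltW.
  rewrite /T; have := ler_norm (K ^+ 2 / (lam * mu)).
  have : 0 <= `|E0| by []; lra.
move: XT; rewrite ler_pdivrMr // => XT.
apply: (le_trans (ler_pM a0 b0 aK bK)).
have := ler_wpM2l (sqr_ge0 (dotv w (xi - r))) XT; lra.
Qed.

(** The point of parameter s is the exit point at the time t given by
    [arc_log_ratio_support_lines], so relfunk equals ln (v / - u) there. *)
Lemma near_relfunk_support_line (e : R) (u v du dv ddu ddv : R -> R)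
    (u1 v1 u2 v2 : R) : 0 < e ->
  right_C2_jet e u du ddu u1 u2 -> right_C2_jet e v dv ddv v1 v2 ->
  u1 < 0 -> 0 < v1 -> 0 < v1 * u2 - u1 * v2 -> 0 <= lam * u1 + mu * v1 ->
  (forall s, 0 < s < e ->
    boundary Omega (xi + u s *: (a - xi) + v s *: (b - xi))) ->
  eventually_support_lines N.
Proof.
move=> e0 ju jv u10 v10 kap m10 bd.
have [d [T [d0 de sgn sl surj]]] :=
  arc_log_ratio_support_lines e0 l0 ju jv u10 v10 kap m10.
exists (1 + `|T|); first by rewrite ltr_wpDr.
have TT : T <= 1 + `|T| by have := ler_norm T; lra.
have NE s t : 0 < s < d ->
    t = ln ((1 - u s - v s) / (lam * u s + mu * v s)) -> N t = ln (v s / - u s).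
  move=> sd tE; have [us vs es ms] := sgn _ sd.
  have EE : expR t * (lam * u s + mu * v s) = 1 - u s - v s.
    by rewrite tE lnK ?posrE ?divr_gt0 // divfK // gt_eqF.
  have h1 := one_add_expR_gt0 t l0; have h2 := one_add_expR_gt0 t m0.
  (* the exit parameter: (1 - sig) and sig are the barycentric weights of p t, q t *)
  pose sig := v s * (1 + mu * expR t).
  have sE : 1 - sig = u s * (1 + lam * expR t) by rewrite /sig; lra.
  have s1 : sig - 1 = - u s * (1 + lam * expR t) by rewrite mulNr -sE opprB.
  have s10 : 0 < sig - 1 by rewrite s1 mulr_gt0 // oppr_gt0.
  have es' : exits Omega (p t) (q t) sig.
    split; first by rewrite -subr_gt0.
    rewrite [X in boundary _ X](_ : _ =
       xi + u s *: (a - xi) + v s *: (b - xi)); last first.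
      have -> : u s = (1 - sig) / (1 + lam * expR t).
        by rewrite sE mulfK // gt_eqF.
      have -> : v s = sig / (1 + mu * expR t) by rewrite /sig mulfK // gt_eqF.
      by apply/rowP => j; rewrite !mxE; ring.
    apply: bd; case/andP: sd => -> sd /=; exact: lt_le_trans de.
  rewrite /relfunk (funkE oO cO (Op t) es') s1.
  have us' : 0 < - u s by rewrite oppr_gt0.
  have sp : 0 < sig by rewrite mulr_gt0.
  rewrite -lnM ?posrE ?divr_gt0 ?mulr_gt0 //; congr ln; rewrite /sig.
  by field; rewrite (lt_eqF us) !gt_eqF.
move=> t0 Tt0; have [s0 s0d t0E] := surj _ (le_lt_trans TT Tt0).
have [k hk] := sl _ s0d; exists k => t Tt.
have [s sd tE] := surj _ (le_lt_trans TT Tt).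
by rewrite (NE _ _ s0d t0E) (NE _ _ sd tE) {1}tE {1}t0E; exact: hk.
Qed.

Lemma C2_relfunk_support_line (e : R) (u v du dv ddu ddv : R -> R)
    (u1 v1 u2 v2 : R) : 0 < e ->
  (forall r, boundary Omega r -> exists w, supports Omega w r) ->
  right_C2_jet e u du ddu u1 u2 -> right_C2_jet e v dv ddv v1 v2 ->
  u1 < 0 -> 0 < v1 -> 0 < v1 * u2 - u1 * v2 ->
  (forall s, 0 < s < e ->
    boundary Omega (xi + u s *: (a - xi) + v s *: (b - xi))) ->
  eventually_support_lines N.
Proof.
move=> e0 sup ju jv u10 v10 kap bd.
have [m10|m10] := leP 0 (lam * u1 + mu * v1).
  exact: (near_relfunk_support_line e0 ju jv u10 v10 kap m10 bd).
have cu := right_C2_jet_quotient e0 ju; have cv := right_C2_jet_quotient e0 jv.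
have H1 : \forall s \near (0 : R)^'+, u s / s < 0 by exact: (cvgr_lt _ cu).
have H2 : \forall s \near (0 : R)^'+, 0 < v s / s by exact: (cvgr_gt _ cv).
have H3 : \forall s \near (0 : R)^'+, lam * (u s / s) + mu * (v s / s) < 0.
  exact: (cvgr_lt _ (cvgD (cvgM (cvg_cst lam) cu) (cvgM (cvg_cst mu) cv)) _ m10).
have : \forall s \near (0 : R)^'+, [/\ u s / s < 0, 0 < v s / s &
    lam * (u s / s) + mu * (v s / s) < 0].
  by near=> s; split; near: s.
(* one point of the arc, close to xi, serves as the boundary point (uw, vw) *)
case/near_right0 => d d0 dP.
have m0' : 0 < Num.min d e by rewrite lt_min d0 e0.
pose s := Num.min d e / 2.
have s0 : 0 < s by rewrite divr_gt0.
have : s < Num.min d e by rewrite ltr_pdivrMr // ltr_pMr // ltr1n.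
rewrite lt_min => /andP[sd se].
have [us vs ms] := dP _ s0 sd.
apply: (far_relfunk_support_line (uw := u s) (vw := v s) sup).
- by move: us; rewrite pmulr_llt0 // invr_gt0.
- by move: vs; rewrite pmulr_lgt0 // invr_gt0.
- by move: ms; rewrite !mulrA -mulrDl pmulr_llt0 // invr_gt0.
- by apply: bd; rewrite s0 se.
Unshelve. all: by end_near. Qed.

End AsymptoticPair.

(** * Coordinates in the plane of the two geodesics *)

Section PlaneCoordinates.
Context {R : realType} {n : nat}.
Implicit Types (x y z xi A B : 'rV[R]_n) (P : set 'rV[R]_n).

Definition independent A B :=
  forall s t : R, s *: A + t *: B = 0 -> s = 0 /\ t = 0.

Lemma asymptote_onto xi a (lam th : R) : 0 < lam -> 0 < th -> th < 1 ->
  exists t, asymptote xi a lam t = xi + th *: (a - xi).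
Proof.
move=> l0 t0 t1; exists (ln ((th^-1 - 1) / lam)).
have h : 0 < th^-1 - 1 by rewrite subr_gt0 invf_gt1.
rewrite /asymptote lnK ?posrE ?divr_gt0 //; congr (_ + _ *: _).
by rewrite mulrCA divff ?gt_eqF // mulr1 addrC subrK invrK.
Qed.

(** If b - xi = k (a - xi), then xi, a or b would be an interior point of a chord
    inside Omega, according to k < 0, k > 1 or 0 < k < 1; and k = 1 makes the two
    images equal. *)
Lemma asymptotes_independent (Omega : set 'rV[R]_n) xi a b (lam mu : R) :
  open Omega -> convex_set Omega -> 0 < lam -> 0 < mu ->
  boundary Omega xi -> boundary Omega a -> boundary Omega b ->
  a != xi -> b != xi ->
  (forall t, Omega (asymptote xi a lam t)) ->
  (forall t, Omega (asymptote xi b mu t)) ->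
  range (asymptote xi a lam) <> range (asymptote xi b mu) ->
  independent (a - xi) (b - xi).
Proof.
move=> oO cO l0 m0 bxi ba bb axi bxi' Op Oq rng s t E.
have nO z : boundary Omega z -> ~ Omega z by move=> /open_boundaryE -/(_ oO)[].
have A0 : a - xi != 0 by rewrite subr_eq0.
have B0 : b - xi != 0 by rewrite subr_eq0.
have [t0|t0] := eqVneq t 0.
  move: E; rewrite t0 scale0r addr0 => /eqP.
  by rewrite scaler_eq0 (negPf A0) orbF => /eqP.
exfalso.
pose k := - s / t.
have BkA : b - xi = k *: (a - xi).
  have : t *: (b - xi) = - s *: (a - xi).
    by apply/eqP; rewrite scaleNr -addr_eq0 addrC E.
  move=> /(congr1 ( *:%R t^-1)); rewrite !scalerA mulVf // scale1r => ->.
  by rewrite /k mulrC.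
have k0 : k != 0.
  by apply/eqP => k0; move: B0; rewrite BkA k0 scale0r eqxx.
have [kn|kp|kz] := ltgtP k 0; last by rewrite kz eqxx in k0.
- have h0 : 0 < 2^-1 :> R by [].
  have h1 : 2^-1 < 1 :> R by rewrite invf_lt1 // ltr1n.
  have [tp pE] := asymptote_onto xi a l0 h0 h1.
  have [tq qE] := asymptote_onto xi b m0 h0 h1.
  have := Op tp; rewrite pE => Ox; have := Oq tq; rewrite qE => Oy.
  have d0 : 0 < 1 - k by lra.
  apply: (nO _ bxi).
  have := convex_segment (t := (1 - k)^-1) cO Ox Oy.
  have -> : xi + 2^-1 *: (a - xi) + (1 - k)^-1 *:
     (xi + 2^-1 *: (b - xi) - (xi + 2^-1 *: (a - xi))) = xi.
    rewrite BkA; move: (a - xi) => A.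
    by apply/rowP => j; rewrite !mxE; field; rewrite gt_eqF.
  by apply; [rewrite invr_ge0 ltW | rewrite invf_le1 //; lra].
- have [k1|k1|kE] := ltgtP k 1.
  + have [tp pE] := asymptote_onto xi a l0 kp k1.
    by apply: (nO _ bb); rewrite -[b](subrK xi) addrC BkA -pE.
  + have kV : k^-1 < 1 by rewrite invf_lt1.
    have kV0 : 0 < k^-1 by rewrite invr_gt0.
    have [tq qE] := asymptote_onto xi b m0 kV0 kV.
    apply: (nO _ ba); have := Oq tq; rewrite qE BkA scalerA mulVf // scale1r.
    by rewrite addrC subrK.
  + apply: rng; move: BkA; rewrite kE scale1r => /addIr ->.
    have th01 (r y : R) : 0 < r ->
        0 < (1 + r * expR y)^-1 /\ (1 + r * expR y)^-1 < 1.
      move=> r0; have h := one_add_expR_gt0 y r0.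
      by rewrite invr_gt0 invf_lt1 // ltrDl mulr_gt0 // expR_gt0.
    rewrite eqEsubset; split => _ [y _ <-].
      have [h1 h2] := th01 _ y l0.
      by have [y' E'] := asymptote_onto xi a m0 h1 h2; exists y'; rewrite // E'.
    have [h1 h2] := th01 _ y m0.
    by have [y' E'] := asymptote_onto xi a l0 h1 h2; exists y'; rewrite // E'.
Qed.

(** The two coordinates are linear forms on the whole space, so that they apply to
    the derivatives of a curve as well. *)
Lemma plane_coordinates P xi a b (lam mu : R) : is_plane P ->
  0 < lam -> 0 < mu -> independent (a - xi) (b - xi) ->
  (forall t, P (asymptote xi a lam t)) -> (forall t, P (asymptote xi b mu t)) ->
  exists wu wv : 'rV[R]_n, forall z, P z ->
    z - xi = dotv wu (z - xi) *: (a - xi) + dotv wv (z - xi) *: (b - xi).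
Proof.
move=> [z0 [M [rM ->]]] l0 m0 ind Pp Pq.
have dir c (r : R) : 0 < r ->
    (forall t, [set x | (x - z0 <= M)%MS] (asymptote xi c r t)) ->
    (c - xi <= M)%MS.
  move=> r0 Pc.
  have -> : c - xi = ((1 + r * expR 0)^-1 - (1 + r * expR 1)^-1)^-1 *:
     ((asymptote xi c r 0 - z0) - (asymptote xi c r 1 - z0)).
    have E : asymptote xi c r 0 - z0 - (asymptote xi c r 1 - z0) =
        ((1 + r * expR 0)^-1 - (1 + r * expR 1)^-1) *: (c - xi).
      by rewrite /asymptote; apply/rowP => j; rewrite !mxE; ring.
    rewrite E scalerA mulVf ?scale1r // gt_eqF // subr_gt0.
    rewrite ltf_pV2 ?posrE ?one_add_expR_gt0 // ltrD2l ltr_pM2l //.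
    by rewrite ltr_expR.
  by rewrite scalemx_sub // addmx_sub ?Pc // eqmx_opp Pc.
have AM := dir _ _ l0 Pp; have BM := dir _ _ m0 Pq.
set A := a - xi in AM ind *; set B := b - xi in BM ind *.
have xiM : (xi - z0 <= M)%MS.
  have -> : xi - z0 = (asymptote xi a lam 0 - z0) - (1 + lam * expR 0)^-1 *: A.
    by rewrite /asymptote /A; apply/rowP => j; rewrite !mxE; ring.
  by rewrite addmx_sub ?Pp // eqmx_opp scalemx_sub.
pose D : 'M[R]_(1 + 1, n) := col_mx A B.
have DM : (D <= M)%MS by rewrite col_mx_sub AM BM.
have comb (y : 'rV[R]_(1 + 1)) :
    y *m D = y ord0 (lshift 1 ord0) *: A + y ord0 (rshift 1 ord0) *: B.
  rewrite -[y in LHS]hsubmxK mul_row_col.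
  by rewrite [lsubmx y]mx11_scalar [rsubmx y]mx11_scalar !mul_scalar_mx !mxE.
have fD : row_free D.
  apply: inj_row_free => y; rewrite comb => /ind[h1 h2].
  by apply/rowP => j; rewrite mxE; case: (split_ordP j) => i ->; rewrite ord1.
have MD : (M <= D)%MS.
  by have [_] := mxrank_leqif_sup DM; rewrite rM (eqP fD) eqxx => <-.
pose K := pinvmx D.
exists (\row_j K j (lshift 1 ord0)), (\row_j K j (rshift 1 ord0)) => z Pz.
have zD : (z - xi <= D)%MS.
  apply: submx_trans MD.
  have -> : z - xi = (z - z0) - (xi - z0) by rewrite opprB addrA subrK.
  by rewrite addmx_sub // eqmx_opp.
rewrite -[LHS](mulmxKpV zD) comb.
have co i : ((z - xi) *m pinvmx D) ord0 i = dotv (\row_j K j i) (z - xi).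
  by rewrite [LHS]mxE; apply: eq_bigr => j _; rewrite [in RHS]mxE mulrC.
by rewrite !co.
Qed.

End PlaneCoordinates.

(** * The tangent and the curvature at xi *)

Section TangentSigns.
Context {R : realType}.

(** Here (u1, v1) and (u2, v2) are the coordinates of a unit vector and of a vector
    orthogonal to it, dA and dB the products of the unit vector with the basis:
    if the two vectors are proportional, then the second one is zero. *)
Lemma orthonormal_coordinates (u1 v1 u2 v2 dA dB : R) :
  u1 * dA + v1 * dB = 1 -> u2 * dA + v2 * dB = 0 ->
  ((u1 != 0) || (v1 != 0)) /\
  (v1 * u2 - u1 * v2 = 0 -> u2 = 0 /\ v2 = 0).
Proof.
move=> h1 h2; split.
  rewrite -negb_and; apply/negP => /andP[/eqP u0 /eqP v0].
  by move/eqP: h1; rewrite u0 v0 !mul0r addr0 eq_sym oner_eq0.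
move=> k0; split.
- transitivity (u2 * (u1 * dA + v1 * dB)); first by rewrite h1 mulr1.
  transitivity (u1 * (u2 * dA + v2 * dB) + (v1 * u2 - u1 * v2) * dB); first by ring.
  by rewrite h2 k0; ring.
- transitivity (v2 * (u1 * dA + v1 * dB)); first by rewrite h1 mulr1.
  transitivity (v1 * (u2 * dA + v2 * dB) - (v1 * u2 - u1 * v2) * dA); first by ring.
  by rewrite h2 k0; ring.
Qed.

(** The form with positive coefficients al and be, which supports Omega at xi,
    vanishes on the tangent and is nonnegative on the second derivative: this
    gives u1 and v1 opposite signs, and the determinant the sign of v1. *)
Lemma tangent_signs (u1 v1 u2 v2 al be : R) : 0 < al -> 0 < be ->
  u1 * al + v1 * be = 0 -> 0 <= u2 * al + v2 * be ->
  (u1 != 0) || (v1 != 0) -> v1 * u2 - u1 * v2 != 0 ->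
  exists sg : R, [/\ sg = 1 \/ sg = -1, sg * u1 < 0, 0 < sg * v1 &
    0 < sg * v1 * u2 - sg * u1 * v2].
Proof.
move=> al0 be0 d1 d2 uv kap0.
have uA : u1 * al = - (v1 * be) by lra.
have u10 : u1 != 0.
  apply/negP => /eqP u1E; move: uv; rewrite u1E eqxx /= => /negP; apply.
  have /eqP : v1 * be = 0 by move: uA; rewrite u1E mul0r; lra.
  by rewrite mulf_eq0 (gt_eqF be0) orbF.
have kapA : al * (v1 * u2 - u1 * v2) = v1 * (u2 * al + v2 * be).
  transitivity (v1 * (u2 * al + v2 * be) - v2 * (u1 * al + v1 * be)); first by ring.
  by rewrite d1 mulr0 subr0.
have [un|up|u1E] := ltgtP u1 0; last by rewrite u1E eqxx in u10.
- have v1p : 0 < v1.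
    rewrite -(pmulr_lgt0 _ be0); suff : u1 * al < 0 by lra.
    by rewrite nmulr_rlt0.
  exists 1; split; rewrite ?mul1r //; first by left.
  have : 0 <= al * (v1 * u2 - u1 * v2) by rewrite kapA mulr_ge0 // ltW.
  rewrite pmulr_rge0 // => k0. by rewrite lt_neqAle eq_sym kap0.
- have v1n : v1 < 0.
    rewrite -(pmulr_llt0 _ be0); suff : 0 < u1 * al by lra.
    by rewrite mulr_gt0.
  exists (-1); split; rewrite ?mulN1r ?oppr_lt0 ?oppr_gt0 //; first by right.
  have : al * (v1 * u2 - u1 * v2) <= 0 by rewrite kapA mulr_le0_ge0 // ltW.
  rewrite pmulr_rle0 // => k0.
  have : v1 * u2 - u1 * v2 < 0 by rewrite lt_neqAle kap0.
  by lra.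
Qed.

End TangentSigns.

Section Tangent.
Context {R : realType} {n : nat}.
Context (Omega : set 'rV[R]_n) (oO : open Omega) (cO : convex_set Omega).
Context (xi A B wu wv w0 : 'rV[R]_n) (e : R) (gamma : R^o -> 'rV[R]_n).
Context (y0 : 'rV[R]_n) (Oy0 : Omega y0).
Context (e0 : 0 < e) (g0 : gamma 0 = xi) (gC2 : C2_on `]- e, e[%classic gamma).
Context (unit_speed : forall s, s \in `]- e, e[ -> enorm ('D_1 gamma s) = 1).
Context (curv : enorm ('D_1 ('D_1 gamma) 0) != 0).
Context (gB : forall s, s \in `]- e, e[ -> boundary Omega (gamma s)).
Context (coord : forall s, s \in `]- e, e[ -> gamma s - xi =
   dotv wu (gamma s - xi) *: A + dotv wv (gamma s - xi) *: B).
Context (sw0 : supports Omega w0 xi) (A0 : 0 < dotv w0 A) (B0 : 0 < dotv w0 B).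

(** The sign sg chooses the half of the curve that leaves xi on the side of b. *)
Lemma tangent_orientation :
  let u1 := dotv wu ('D_1 gamma 0) in let v1 := dotv wv ('D_1 gamma 0) in
  let u2 := dotv wu ('D_1 ('D_1 gamma) 0) in
  let v2 := dotv wv ('D_1 ('D_1 gamma) 0) in
  exists sg : R, [/\ sg = 1 \/ sg = -1, sg * u1 < 0, 0 < sg * v1 &
    0 < sg * v1 * u2 - sg * u1 * v2].
Proof.
move=> u1 v1 u2 v2.
have lin (x c d y z : R) : x - c * y - d * z = 0 -> x = y * c + z * d.
  by move=> H; lra.
have exp w : dotv w ('D_1 gamma 0) = u1 * dotv w A + v1 * dotv w B /\
   dotv w ('D_1 ('D_1 gamma) 0) = u2 * dotv w A + v2 * dotv w B.
  (* w' kills the curve minus xi, by the coordinate identity *)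
  pose w' := w - dotv w A *: wu - dotv w B *: wv.
  have w'E x : dotv w' x = dotv w x - dotv w A * dotv wu x - dotv w B * dotv wv x.
    by rewrite dotvC /w' !dotvB !dotvZ ![dotv x _]dotvC.
  have [] := @curve_annihilator _ _ _ _ xi e0 gC2 w'.
    move=> s se; have := congr1 (dotv w) (coord se); rewrite w'E.
    by move: (gamma s - xi) => z ->; rewrite dotvD !dotvZ; ring.
  by rewrite !w'E => /lin h1 /lin h2.
have pos sg : sg = 1 \/ sg = -1 ->
    0 <= sg * dotv w0 ('D_1 gamma 0) /\
    (sg * dotv w0 ('D_1 gamma 0) = 0 -> 0 <= dotv w0 ('D_1 ('D_1 gamma) 0)).
  move=> sg1; apply: (right_C2_jet_ge0 e0 (curve_right_C2_jet e0 g0 gC2 w0 sg1)).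
  move=> s /(sign_mul_in_itv sg1) /gB /open_boundaryE -/(_ oO) [cs _].
  exact: (supports_closure oO cO sw0 Oy0 cs).
have [h1 h1'] := pos 1 (or_introl erefl).
have [h2 _] := pos (-1) (or_intror erefl).
rewrite mul1r in h1 h1'; rewrite mulN1r oppr_ge0 in h2.
have d1 : dotv w0 ('D_1 gamma 0) = 0 by apply/eqP; rewrite eq_le h1 h2.
have {h1'} := h1' d1; rewrite (exp w0).2 => d2; rewrite (exp w0).1 in d1.
have [x11 x12] := unit_speed_orthogonal e0 gC2 unit_speed.
rewrite (exp _).1 in x11; rewrite (exp _).2 in x12.
have [uv1 uv2] := orthonormal_coordinates x11 x12.
apply: (tangent_signs A0 B0 d1 d2 uv1); apply/eqP => kap.
move/eqP: curv; apply.
have [u20 v20] := uv2 kap.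
by rewrite /enorm (exp _).2 u20 v20 !mul0r addr0 sqrtr0.
Qed.

End Tangent.

Theorem theorem1 (R : realType) (n : nat) (hn : (2 <= n)%N)
    (Omega : set 'rV[R]_n)
    (Omega_open : open Omega) (Omega_convex : convex_set Omega)
    (Omega_bounded : bounded_set Omega)
    (f g : R -> 'rV[R]_n)
    (f_geod : geodesic_line Omega f) (g_geod : geodesic_line Omega g)
    (xi : 'rV[R]_n) (xi_boundary : boundary Omega xi)
    (f_xi : f t @[t --> +oo] --> xi) (g_xi : g t @[t --> +oo] --> xi)
    (fg_distinct : range f <> range g)
    (P : set 'rV[R]_n) (P_plane : is_plane P)
    (fP : range f `<=` P) (gP : range g `<=` P)
    (hab : (exists2 Q, convex_polytope Q & Omega = interior Q) \/
           (C2_boundary Omega /\ curvature (boundary Omega `&` P) xi != 0)) :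
  exists2 T : R, 0 < T &
    @convex_function R R^o `]T, +oo[ (fun t => hilbert Omega (f t) (g t)).
Proof.
have [a [lam [l0 ba axi fE]]] :=
  geodesic_lineE Omega_open Omega_convex Omega_bounded f_geod f_xi.
have [b [mu [m0 bb bxi gE]]] :=
  geodesic_lineE Omega_open Omega_convex Omega_bounded g_geod g_xi.
have {}fE : f = asymptote xi a lam by apply/funext.
have {}gE : g = asymptote xi b mu by apply/funext.
have [fO _ _] := f_geod; have [gO _ _] := g_geod.
rewrite fE in fO fP fg_distinct *; rewrite gE in gO gP fg_distinct *.
have ind := asymptotes_independent Omega_open Omega_convex l0 m0 xi_boundary
  ba bb axi bxi fO gO fg_distinct.
have pq t : asymptote xi a lam t != asymptote xi b mu t.
  apply/eqP => /addrI /eqP; rewrite -subr_eq0 -scaleNr => /eqP /ind[+ _].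
  by move/eqP; rewrite invr_eq0 gt_eqF // one_add_expR_gt0.
have qp t : asymptote xi b mu t != asymptote xi a lam t by rewrite eq_sym.
suff [N1 N2] : eventually_support_lines (relfunk Omega xi a b lam mu) /\
               eventually_support_lines (relfunk Omega xi b a mu lam).
  apply: (eventually_support_lines_sum _ N1 N2) => t.
  rewrite hilbert_funk // /relfunk.
  have h1 := one_add_expR_gt0 t l0; have h2 := one_add_expR_gt0 t m0.
  move: (funk _ _ _) (funk _ _ _) => F1 F2.
  by rewrite !ln_div ?posrE //; ring.
case: hab => [[Q [_ [k [nrm [off [nrm0 ->]]]]] OE]|[C2 curv]].
  split.
    exact: (polytope_relfunk_support_line Omega_open Omega_convex Omega_bounded
      xi_boundary ba bb l0 m0 fO gO pq nrm0 OE).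
  exact: (polytope_relfunk_support_line Omega_open Omega_convex Omega_bounded
      xi_boundary bb ba m0 l0 gO fO qp nrm0 OE).
have sup r : boundary Omega r -> exists w, supports Omega w r.
  exact: C2_boundary_supports.
have [wu [wv coord]] := plane_coordinates P_plane l0 m0 ind
  (fun t => fP _ (ex_intro2 _ _ t I erefl)) (fun t => gP _ (ex_intro2 _ _ t I erefl)).
move: curv; rewrite /curvature.
case: xgetP => [k _ [e [gamma [[[e0 g0] gC2 us _ [U _ CU]] ->]]] curv|_]; last first.
  by rewrite eqxx.
have gCP s : s \in `]- e, e[ -> boundary Omega (gamma s) /\ P (gamma s).
  move=> se; have : (gamma @` `]- e, e[%classic) (gamma s) by exists s.
  by rewrite -CU => -[[]].
have [w0 sw0] := sup _ xi_boundary.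
have pos c (r : R) : 0 < r -> (forall t, Omega (asymptote xi c r t)) ->
    0 < dotv w0 (c - xi).
  move=> r0 Oc; have := sw0 _ (Oc 0); rewrite /asymptote addrAC subrr add0r dotvZ.
  by rewrite pmulr_rgt0 // invr_gt0 one_add_expR_gt0.
have [sg [sg1 u1 v1 kap]] := tangent_orientation Omega_open Omega_convex
  (fO 0) e0 g0 gC2 us curv (fun s se => (gCP s se).1)
  (fun s se => coord _ (gCP s se).2) sw0 (pos _ _ l0 fO) (pos _ _ m0 gO).
have sgN : - sg = 1 \/ - sg = -1.
  by case: sg1 => ->; [right|left; rewrite opprK].
have bd (r s : R) : r = 1 \/ r = -1 -> 0 < s < e ->
    boundary Omega (xi + dotv wu (gamma (r * s) - xi) *: (a - xi) +
                         dotv wv (gamma (r * s) - xi) *: (b - xi)).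
  move=> r1 se.
  have [bg Pg] := gCP _ (sign_mul_in_itv r1 se).
  by rewrite -addrA -(coord _ Pg) addrC subrK.
have jet := curve_right_C2_jet e0 g0 gC2.
split.
  apply: (C2_relfunk_support_line Omega_open Omega_convex Omega_bounded
    xi_boundary ba bb l0 m0 fO gO pq e0 sup (jet wu sg sg1) (jet wv sg sg1)) => //.
  by move=> s; exact: bd.
(* for the other end, the roles of u and v are exchanged on the other half *)
apply: (C2_relfunk_support_line Omega_open Omega_convex Omega_bounded
    xi_boundary bb ba m0 l0 gO fO qp e0 sup (jet wv _ sgN) (jet wu _ sgN)) => //.
- by rewrite mulNr oppr_lt0.
- by rewrite mulNr oppr_gt0.
- by rewrite !mulNr opprK addrC.
- by move=> s se; rewrite addrAC; exact: bd.
Qed.
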